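(* Let $0<\alpha<mn$ and let $T_\alpha^m$ be a multilinear fractional operator whose kernel $K_\alpha$ satisfies the size condition and the smoothness condition (with exponent $0<\gamma\le 1$) stated in the context. Let $0<\delta<\min\{\gamma,(mn-\alpha)/m\}$, $\tilde\alpha=\alpha+m\delta$, and let $\vec p=(p_1,\dots,p_m)$ be a vector of exponents, $1\le p_i\le\infty$, with $p>n/\tilde\alpha$. Let $\bm b=(b_1,\dots,b_m)$ with $b_i\in\Lambda(\delta)$ for $1\le i\le m$. Let $\tilde\delta\le\delta$ and let $(w,\vec v)$ be a pair of weights in $\mathcal H_m(\vec p,\tilde\alpha,\tilde\delta)$ (the class defined in the context with $\beta=\tilde\alpha$ and with the same parameter $\delta$) such that $v_i^{-p_i'}\in \mathrm{RH}_m$ for every $i$ with $1<p_i\le\infty$. Then the multilinear product commutator $\mathcal T_{\alpha,\bm b}^m$ is bounded from $\prod_{i=1}^m L^{p_i}(v_i^{p_i})$ to $\mathcal L_w(\tilde\delta)$, that is, there exists a positive constant $C$ such that $$\frac{1}{w^{-1}(B)|B|^{\tilde\delta/n}}\int_B \left|\mathcal T_{\alpha,\bm b}^m\vec f(x)-(\mathcal T_{\alpha,\bm b}^m\vec f)_B\right|dx\le C\prod_{i=1}^m\|f_iv_i\|_{p_i}$$ for every ball $B\subset\mathbb R^n$ and every $\vec f=(f_1,\dots,f_m)$ such that $f_iv_i\in L^{p_i}$ for $1\le i\le m$.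
   Context: Notation. $m\in\mathbb N$; $1/p=\sum_{i=1}^m 1/p_i$; $p_i'$ is the conjugate exponent of $p_i$ ($1/p_i+1/p_i'=1$); $|B|$ is Lebesgue measure; $g_B=\frac1{|B|}\int_B g$; $w^{-1}(B)=\int_B w^{-1}$. A weight is a locally integrable function $w$ on $\mathbb R^n$ with $0<w(x)<\infty$ for almost every $x$; $\vec v=(v_1,\dots,v_m)$ is a vector of weights. $f\in L^{p_i}(v_i^{p_i})$ means $fv_i\in L^{p_i}$. Operators. For $0<\alpha<mn$, $$T_\alpha^m\vec f(x)=\int_{(\mathbb R^n)^m}K_\alpha(x,\vec y)\prod_{i=1}^m f_i(y_i)\,d\vec y,\qquad \vec y=(y_1,\dots,y_m).$$ Size condition: there is a constant $C$ with $|K_\alpha(x,\vec y)|\le C\left(\sum_{i=1}^m|x-y_i|\right)^{-(mn-\alpha)}$. Smoothness condition: for some $0<\gamma\le1$ and some fixed constants $C,c>0$, $$|K_\alpha(x,\vec y)-K_\alpha(x',\vec y)|\le C\frac{|x-x'|^\gamma}{\left(\sum_{i=1}^m|x-y_i|\right)^{mn-\alpha+\gamma}}\quad\text{whenever }\sum_{i=1}^m|x-y_i|>c|x-x'|.$$ Product commutator. For a multilinear operator $T$ and a function $b$, $[b,T]_j(\vec f)=bT(\vec f)-T(f_1,\dots,bf_j,\dots,f_m)$. Then $\mathcal T_{\alpha,\bm b}^m\vec f=[b_m,\dots[b_2,[b_1,T_\alpha^m]_1]_2\dots]_m\vec f$, which (formally) has the integral representation $$\mathcal T_{\alpha,\bm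 b}^m\vec f(x)=\int_{(\mathbb R^n)^m}K_\alpha(x,\vec y)\prod_{i=1}^m(b_i(x)-b_i(y_i))f_i(y_i)\,d\vec y.$$ Lipschitz symbols. For $0<\delta<1$, $b\in\Lambda(\delta)$ if there is $C$ with $|b(x)-b(y)|\le C|x-y|^\delta$ for all $x,y\in\mathbb R^n$. Weighted Lipschitz space. $\mathcal L_w(\tilde\delta)$ is the set of locally integrable $f$ with $\sup_B\frac{1}{w^{-1}(B)|B|^{\tilde\delta/n}}\int_B|f-f_B|<\infty$, the supremum over all balls $B$. Class of weights. Let $\delta,\beta,\tilde\delta$ be real with $0<\beta<mn$. $(w,\vec v)\in\mathcal H_m(\vec p,\beta,\tilde\delta)$ means that $w^{-1}$ is locally integrable and there are numbers $\beta_1,\dots,\beta_m$ with $0<\beta_i<n$, $\sum_{i=1}^m\beta_i=\beta$, and a constant $C>0$ such that $$\frac{|B|^{1+(\delta-\tilde\delta)/n}}{w^{-1}(B)}\prod_{i=1}^m\left\|\frac{v_i^{-1}}{(|B|^{1/n}+|x_B-\cdot|)^{n-\beta_i+\delta/m}}\right\|_{p_i'}\le C$$ for every ball $B=B(x_B,R)$. Reverse Hölder classes. For $1<s<\infty$, a weight $u\in\mathrm{RH}_s$ if there is $C$ with $\left(\frac1{|B|}\int_Bu^s\right)^{1/s}\le\frac{C}{|B|}\int_Bu$ for every ball $B$. For $m=1$ the condition $u\in\mathrm{RH}_1$ imposes no additional assumption. *)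

(* Defs.v *)
From HB Require Import structures.
From mathcomp Require Import all_boot all_order all_algebra.
From mathcomp Require Import all_classical all_reals all_analysis.
Set Implicit Arguments.
Unset Strict Implicit.
Unset Printing Implicit Defensive.
Import Order.TTheory GRing.Theory Num.Theory.
Import numFieldNormedType.Exports.
Local Open Scope classical_set_scope.
Local Open Scope ring_scope.

Section tuple_measure.
Context d (T : measurableType d) (R : realType).
Variable mu : {sigma_finite_measure set T -> \bar R}.

Definition cons_pair n (z : T * n.-tuple T) : n.+1.-tuple T :=
  [the n.+1.-tuple T of z.1 :: z.2].

Lemma measurable_cons_pair n : measurable_fun setT (@cons_pair n).
Proof. exact: measurable_cons. Qed.

Section step.
Variables (n : nat) (nu : {sigma_finite_measure set (n.-tuple T) -> \bar R}).

Definition tuple_measureS : set (n.+1.-tuple T) -> \bar R :=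
  pushforward (mu \x nu)%E (@cons_pair n).

Let m0 : tuple_measureS set0 = 0%E.
Proof. by rewrite /tuple_measureS /pushforward preimage_set0 measure0. Qed.

Let m_ge0 A : (0 <= tuple_measureS A)%E.
Proof. by rewrite /tuple_measureS /pushforward; apply: measure_ge0. Qed.

Let m_sigma_additive : semi_sigma_additive tuple_measureS.
Proof.
pose p : {measure set _ -> \bar R} := measure_function_pushforward__canonical__measure_function_Measure
  (mu \x nu)%E (@measurable_cons_pair n).
exact: (@measure_semi_sigma_additive _ _ _ p).
Qed.

HB.instance Definition _ := isMeasure.Build _ _ _ tuple_measureS
  m0 m_ge0 m_sigma_additive.

Let m_sigma_finite : sigma_finite setT tuple_measureS.
Proof.
have /sigma_finiteP[F [FT ndF Foo]] := sigma_finiteT mu.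
have /sigma_finiteP[G [GT ndG Goo]] := sigma_finiteT nu.
pose g (t : n.+1.-tuple T) := (thead t, [tuple of behead t]).
have Kg : cancel (@cons_pair n) g.
  by move=> [a t]; rewrite /g /cons_pair theadE /=; congr pair; exact/val_inj.
have mg : measurable_fun setT g.
  apply: measurable_fun_pair => /=; first exact: measurable_tnth.
  exact: measurable_behead.
exists (fun k => g @^-1` (F k `*` G k)).
  rewrite -preimage_bigcup (_ : \bigcup_k _ = setT) ?preimage_setT//.
  apply/seteqP; split=> // -[x y] _.
  have [k _ Fk] : (\bigcup_k F k) x by rewrite -FT.
  have [l _ Gl] : (\bigcup_k G k) y by rewrite -GT.
  exists (maxn k l) => //; split => /=.
  - by move: x Fk; exact/subsetPset/ndF/leq_maxl.
  - by move: y Gl; exact/subsetPset/ndG/leq_maxr.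
move=> k; have [mF Fk] := Foo k; have [mG Gk] := Goo k; split.
  by rewrite -[X in measurable X]setTI; apply: mg => //; exact: measurableX.
rewrite /tuple_measureS /pushforward -comp_preimage.
rewrite (_ : g \o _ = id); last by apply/funext => z /=; rewrite Kg.
rewrite preimage_id product_measure1E// lte_mul_pinfty// ge0_fin_numE//.
Qed.

HB.instance Definition _ := Measure_isSigmaFinite.Build _ _ _ tuple_measureS
  m_sigma_finite.
End step.

(* The n-fold product of [mu], see [tuple_measure_box]. *)
Fixpoint tuple_measure n : {sigma_finite_measure set (n.-tuple T) -> \bar R} :=
  match n with
  | 0 => dirac [tuple]
  | n'.+1 => tuple_measureS (tuple_measure n')
  end.

Lemma tuple_measure_box n (A : 'I_n -> set T) :
  (forall i, measurable (A i)) ->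
  tuple_measure n [set t | forall i, A i (tnth t i)] = (\prod_(i < n) mu (A i))%E.
Proof.
elim: n A => [|n IH] A mA.
  rewrite big_ord0 /= diracE.
  by rewrite mem_set// => -[].
rewrite big_ord_recl -IH; last by move=> i; exact: mA.
rewrite /= /tuple_measureS /pushforward -product_measure1E//; last first.
  rewrite (_ : [set t | _] = \bigcap_(i in setT) ((@tnth n T) ^~ i @^-1` A (lift ord0 i))).
    apply: fin_bigcap_measurable => // i _.
    by rewrite -[X in measurable X]setTI; exact: measurable_tnth.
  by apply/seteqP; split => t /= h i; [move=> _; exact: h|exact: h].
congr ((mu \x _)%E _).
apply/seteqP; split => -[a t] /=.
  move=> h; split; first exact: (h ord0).
  by move=> i; have := h (lift ord0 i); rewrite tnthS.
move=> [a0 h] i; case: (unliftP ord0 i) => [j ->|->//].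
by rewrite tnthS; exact: h.
Qed.
End tuple_measure.

(* R^n with its Borel sigma-algebra; the Euclidean distance is [eucl_dist]. *)
Notation euclid R n := (n.-tuple (measurableTypeR R)).

Section euclidean.
Context {R : realType} {n : nat}.
Implicit Types (x y c : euclid R n) (g w u b : euclid R n -> R).

Definition leb : {sigma_finite_measure set (euclid R n) -> \bar R} :=
  tuple_measure (@lebesgue_measure R) n.

Definition eucl_dist x y : R := Num.sqrt (\sum_(i < n) (tnth x i - tnth y i) ^+ 2).

Definition eball c (r : R) : set (euclid R n) := [set x | eucl_dist c x < r].

Definition loc_integrable g :=
  measurable_fun setT g /\ forall c r, leb.-integrable (eball c r) (EFin \o g).

Definition mean g (B : set (euclid R n)) : R :=
  (fine (leb B))^-1 * \int[leb]_(x in B) g x.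

(* The values of a weight on a null set are unconstrained. *)
Definition weight w := loc_integrable w /\ {ae leb, forall x, 0 < w x}.

Definition Lipschitz_space (delta : R) b :=
  exists C : R, forall x y, `|b x - b y| <= C * eucl_dist x y `^ delta.

Definition weighted_oscillation w (dt : R) g (B : set (euclid R n)) : \bar R :=
  (((\int[leb]_(x in B) (w x)^-1%:E) * leb B `^ (dt / n%:R))^-1 *
   \int[leb]_(x in B) `|g x - mean g B|%:E)%E.

Definition reverse_holder (s : R) u :=
  weight u /\ exists C : R, forall (c : euclid R n) (r : R), 0 < r ->
    let B := eball c r in
    (((leb B)^-1 * \int[leb]_(x in B) (u x `^ s)%:E) `^ s^-1 <=
     C%:E * ((leb B)^-1 * \int[leb]_(x in B) (u x)%:E))%E.

End euclidean.
Arguments leb {R} n.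

Section operators.
Context {R : realType} {n m : nat}.
Implicit Types (x : euclid R n) (y : m.-tuple (euclid R n)).
Implicit Types (K : euclid R n -> m.-tuple (euclid R n) -> R).
Implicit Types (b f v : 'I_m -> euclid R n -> R).

Definition lebm : {sigma_finite_measure set (m.-tuple (euclid R n)) -> \bar R} :=
  tuple_measure (leb n) m.

Definition sum_eucl_dist x y : R := \sum_(i < m) eucl_dist x (tnth y i).

(* On the diagonal [y_1 = ... = y_m = x] the bound is infinite, while the
   library sets [0 `^ a = 0] for [a != 0]; hence the restriction. *)
Definition size_condition (alpha : R) K :=
  exists C : R, forall x y, 0 < sum_eucl_dist x y ->
    `|K x y| <= C * sum_eucl_dist x y `^ (- ((m * n)%:R - alpha)).

Definition smoothness_condition (alpha gamma : R) K :=
  exists C c : R, [/\ 0 < C, 0 < c & forall x x' y,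
    c * eucl_dist x x' < sum_eucl_dist x y ->
    `|K x y - K x' y| <= C * (eucl_dist x x' `^ gamma /
                              sum_eucl_dist x y `^ ((m * n)%:R - alpha + gamma))].

Definition fractional_operator K f x : R :=
  \int[lebm]_y (K x y * \prod_(i < m) f i (tnth y i)).

Definition commutator (j : 'I_m) (bj : euclid R n -> R)
    (T : ('I_m -> euclid R n -> R) -> euclid R n -> R) f x : R :=
  bj x * T f x -
  T (fun i => if i == j then fun z => bj z * f i z else f i) x.

Definition iterated_commutator b T :=
  foldl (fun T j => commutator j (b j) T) T (enum 'I_m).

Definition commutator_integrand K b f x y : R :=
  K x y * \prod_(i < m) ((b i x - b i (tnth y i)) * f i (tnth y i)).

(* The integral representation of the iterated commutator, see
   [iterated_commutatorE] below. Like any [Rintegral], it takes the value [0]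
   at the points where the integral does not converge absolutely. *)
Definition product_commutator K b f x : R :=
  \int[lebm]_y commutator_integrand K b f x y.

Let integrand (A : seq 'I_m) K b f x y : R :=
  K x y * \prod_(i < m) ((if i \in A then b i x - b i (tnth y i) else 1) *
                          f i (tnth y i)).

Let expanded (A : {set 'I_m}) K b f x y : R :=
  K x y * \prod_(i < m) ((if i \in A then b i (tnth y i) else 1) *
                          f i (tnth y i)).

Let foldl_commutatorE K b x (s : seq 'I_m) : uniq s ->
  forall f, (forall A : {set 'I_m}, {subset A <= s} ->
    lebm.-integrable setT (EFin \o expanded A K b f x)) ->
  lebm.-integrable setT (EFin \o integrand s K b f x) /\
  foldl (fun T j => commutator j (b j) T) (fractional_operator K) s f x =
  \int[lebm]_y integrand s K b f x y.
Proof.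
elim/last_ind: s => [_ f fi|s j IH].
  have E : integrand [::] K b f x = expanded finset.set0 K b f x.
    apply/funext => y; rewrite /integrand /expanded; congr (_ * _).
    by apply: eq_bigr => i _; rewrite !inE.
  split; first by rewrite E; apply: fi => i; rewrite inE.
  rewrite /fractional_operator /=; congr (Rintegral _ _ _).
  apply/funext => y; congr (_ * _).
  by apply: eq_bigr => i _; rewrite mul1r.
rewrite rcons_uniq => /andP[js us] f fi.
set f' := fun i => if i == j then fun z => b j z * f i z else f i.
have [i1 e1] : lebm.-integrable setT (EFin \o integrand s K b f x) /\
    foldl (fun T j => commutator j (b j) T) (fractional_operator K) s f x =
    \int[lebm]_y integrand s K b f x y.
  by apply: (IH us) => A As; apply: fi => i /As; rewrite mem_rcons inE orbC => ->.
have [i2 e2] : lebm.-integrable setT (EFin \o integrand s K b f' x) /\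
    foldl (fun T j => commutator j (b j) T) (fractional_operator K) s f' x =
    \int[lebm]_y integrand s K b f' x y.
  apply: (IH us) => A As.
  have jA : j \notin A by apply: contra js; exact: As.
  rewrite (_ : expanded A K b f' x = expanded (j |: A) K b f x).
    apply: fi => i; rewrite !inE mem_rcons inE => /orP[->//|/As ->].
    by rewrite orbT.
  apply/funext => y; rewrite /expanded /f'; congr (_ * _).
  apply: eq_bigr => i _; rewrite !inE.
  by have [->|] //= := eqVneq i j; rewrite (negbTE jA) mul1r.
have E y : integrand (rcons s j) K b f x y =
    b j x * integrand s K b f x y - integrand s K b f' x y.
  rewrite /integrand mulrCA -mulrBr; congr (_ * _).
  rewrite !(bigD1 j (P := predT))//= /f' eqxx (negbTE js) mem_rcons mem_head /=.
  set P := \prod_(i < m | _) _; set P1 := \prod_(i < m | _) _.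
  set P2 := \prod_(i < m | _) _.
  have -> : P = P1.
    by apply: eq_bigr => i ij; rewrite mem_rcons in_cons (negbTE ij).
  have -> : P2 = P1 by apply: eq_bigr => i ij; rewrite (negbTE ij).
  by rewrite !mul1r !mulrBl !mulrA.
have i3 : lebm.-integrable setT
    (EFin \o (fun y => b j x * integrand s K b f x y)).
  rewrite (_ : _ \o _ = (fun y => (b j x)%:E * (EFin \o integrand s K b f x) y)%E).
    exact: integrableZl.
  by apply/funext => y /=; rewrite EFinM.
split.
  rewrite (_ : _ \o _ = ((EFin \o (fun y => (b j x * integrand s K b f x y)%R)) \-
      (EFin \o integrand s K b f' x))%E).
    exact: integrableB.
  by apply/funext => y /=; rewrite E EFinB.
rewrite foldl_rcons {1}/commutator e1 -/f' e2 -RintegralZl// -RintegralB//.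
by congr (Rintegral _ _ _); apply/funext => y; rewrite E.
Qed.

Lemma iterated_commutatorE K b f x :
  (forall A : {set 'I_m}, lebm.-integrable setT (fun y => (K x y *
    \prod_(i < m) ((if i \in A then b i (tnth y i) else 1) *
                   f i (tnth y i)))%:E)) ->
  iterated_commutator b (fractional_operator K) f x =
  product_commutator K b f x.
Proof.
move=> fi; have [|_] := foldl_commutatorE (enum_uniq 'I_m) (f := f) (b := b) (K := K) (x := x).
  by move=> A _; exact: fi.
rewrite /iterated_commutator => ->.
congr (Rintegral _ _ _); apply/funext => y; congr (_ * _).
by apply: eq_bigr => i _; rewrite mem_enum.
Qed.

(* For general [f] in the product of the weighted Lebesgue spaces the integral
   defining the commutator may diverge at infinity, whereas the difference of
   its integrands at two points is integrable. [F] is then a version of the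
   commutator modulo additive constants, which oscillations do not see. *)
Definition commutator_mod_constants K b f (F : euclid R n -> R) :=
  \forall x \ae leb n, \forall z \ae leb n,
    lebm.-integrable setT (fun y =>
      (commutator_integrand K b f x y - commutator_integrand K b f z y)%:E) /\
    F x - F z = \int[lebm]_y
      (commutator_integrand K b f x y - commutator_integrand K b f z y).

Definition weight_class (p : 'I_m -> \bar R) (beta delta dt : R)
    (w : euclid R n -> R) v :=
  loc_integrable (fun x => (w x)^-1) /\
  exists (beta_ : 'I_m -> R) (C : R),
    [/\ forall i, 0 < beta_ i < n%:R,
        \sum_(i < m) beta_ i = beta,
        0 < C &
        forall (c : euclid R n) (r : R), 0 < r ->
        let B := eball c r in
        (leb n B `^ (1 + (delta - dt) / n%:R) /
           (\int[leb n]_(x in B) (w x)^-1%:E) *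
         \prod_(i < m) 'N[leb n]_(hoelder_conjugate (p i))
           [EFin \o (fun z : euclid R n => (v i z)^-1 /
             (fine (leb n B) `^ n%:R^-1 + eucl_dist c z)
               `^ (n%:R - beta_ i + delta / m%:R))%R]
         <= C%:E)%E].

End operators.
Arguments lebm {R} n m.

(* Main.v *)
Require Import Defs.
From mathcomp Require Import all_boot all_order all_algebra.
From mathcomp Require Import all_classical all_reals all_analysis.
From mathcomp Require Import measurable_realfun ess_sup_inf ring lra.

(** Let [g x y] be the integrand of the commutator at [x], as a function of
    [y = (y_1, ..., y_m)]. For a ball [B] of radius [r] it is enough to bound the
    integral over [y] of [|g x y - g z y|], for [x] and [z] in [B], by
    [N x + N z + A] where [2 * int_B N + A |B|] is at most a constant times
    [w^-1(B) |B|^(dt/n) prod_i |f_i v_i|_(p_i)]: the mean oscillation over [B] of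
    any function whose increments are controlled by these integrals is then at
    most that quantity ([mean_oscillation_le]). Here [N x] is the integral of
    [|g x y|] over the [y] whose entries all lie in a fixed dilate [D] of [B],
    and [A] bounds the integral of [|g x y - g z y|] over the other [y].

    Away from [D] the smoothness of the kernel and that of the symbols gain
    [(r / S)^delta], where [S] is the sum of the distances [|x - y_i|]. As [S]
    dominates each [r + |x_B - y_i|], the difference is at most [C r^delta] times
    a product of functions of separate variables with the exponents that occur in
    the class of weights ([far_difference_le]); Tonelli's theorem and Hoelder's
    inequality then give the product of the norms of the class.

    Near [B] one has [|g x y| <= C S^(-lam) prod_i |f_i (y_i)|] with
    [lam = m n - alpha - m delta]. The reverse Hoelder condition gives
    [v_i^-1] the local integrability exponent [m p_i'], so that [|f_i|] is at most
    a number times [H_i^(1/p_i) U_i^((1 - 1/p_i)/m)] with [H_i] and [U_i] of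
    integral at most one ([factor_bounds]). Because [1/p < (alpha + m delta)/n],
    [S^(-lam)] is at most a constant times a power of [r] times
    [prod_i k(x, y_i)^(1 - (1 - 1/m)/p_i)], for the normalized Riesz kernel
    [k(x, y) = r^(-eps) |x - y|^(-(n - eps))] with a small [eps]
    ([near_kernel_le]). The resulting product is a geometric mean over
    [j = 1, ..., m] of products in which [k(x, y_j)] appears with exponent one,
    [H_j^(1/p_j) U_j^(1 - 1/p_j)] multiplies it, and every other variable only
    carries [H_i^(1/p_i) k(x, y_i)^(1 - 1/p_i)]. The weighted
    arithmetic-geometric inequality turns these into sums that are integrated
    one variable at a time ([prod_powR_le_sum], [multilinear_form_le]). No
    boundedness theorem for fractional integrals is needed, because the
    inequality [1/p < (alpha + m delta)/n] is strict and [D] is bounded.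

    Since [N] is integrable over every ball, the set [G] of the points where it
    is finite for all balls of integer radius centred at the origin that contain
    the point has full measure, and for [x] and [z] in [G] the function [g x - g z] is integrable. The integral of
    [g x - g z0], for a fixed [z0] in [G], is the representative of the commutator
    modulo constants. As for the commutator itself, either [g x] is integrable
    for every [x] in [G] or for none, and in the second case the commutator
    vanishes on [G]; its increments are controlled in both cases. *)

Import Order.TTheory GRing.Theory Num.Theory.
Import numFieldNormedType.Exports.
Set Implicit Arguments.
Unset Strict Implicit.
Unset Printing Implicit Defensive.
Local Open Scope classical_set_scope.
Local Open Scope ring_scope.

(** * Tonelli's theorem for tuples *)

Section tonelli_for_tuples.
Context d (T : measurableType d) (R : realType).
Variable mu : {sigma_finite_measure set T -> \bar R}.
Local Open Scope ereal_scope.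

Lemma emeasurable_prod d' (S : measurableType d') n (F : 'I_n -> S -> \bar R) :
  (forall i, measurable_fun setT (F i)) ->
  measurable_fun setT (fun x => \prod_(i < n) F i x).
Proof.
elim: n F => [|n IH] F mF.
  by rewrite (_ : (fun _ => _) = cst 1)//; apply/funext => x; rewrite big_ord0.
rewrite (_ : (fun _ => _) = F ord0 \* (fun x => \prod_(i < n) F (lift ord0 i) x)).
  by apply: emeasurable_funM; [exact: mF|exact: IH].
by apply/funext => x; rewrite big_ord_recl.
Qed.

Lemma prode_nonneg (I : finType) (P : pred I) (x : I -> \bar R) :
  (forall i, P i -> 0 <= x i) -> 0 <= \prod_(i | P i) x i.
Proof. by move=> x0; elim/big_ind: _ => //; exact: mule_ge0. Qed.

(** Tonelli's theorem for a product of functions of separate variables. *)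
Lemma integral_tuple_prod n (F : 'I_n -> T -> \bar R) :
  (forall i, measurable_fun setT (F i)) -> (forall i x, 0 <= F i x) ->
  \int[tuple_measure mu n]_t \prod_(i < n) F i (tnth t i) =
  \prod_(i < n) \int[mu]_x F i x.
Proof.
elim: n F => [|n IH] F mF F0.
  rewrite big_ord0 (eq_integral (cst 1)); last first.
    by move=> x _; rewrite big_ord0.
  by rewrite integral_cst// mul1e /= diracE in_setT.
have mP k (G : 'I_k -> T -> \bar R) : (forall i, measurable_fun setT (G i)) ->
    measurable_fun setT (fun t : k.-tuple T => \prod_(i < k) G i (tnth t i)).
  move=> mG; apply: (@emeasurable_prod _ _ _ (fun i t => G i (tnth t i))) => i.
  by apply: measurableT_comp => //; exact: measurable_tnth.
pose p : {measure set _ -> \bar R} :=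
  measure_function_pushforward__canonical__measure_function_Measure
    (mu \x tuple_measure mu n) (@measurable_cons_pair _ T n).
rewrite (@eq_measure_integral _ _ _ setT p)//.
rewrite ge0_integral_pushforward//=; last 2 first.
- exact: mP.
- by move=> y _; apply: prode_nonneg.
rewrite preimage_setT.
pose G (z : T * n.-tuple T) := F ord0 z.1 * \prod_(i < n) F (lift ord0 i) (tnth z.2 i).
rewrite (eq_integral G); last first.
  move=> z _; rewrite /= big_ord_recl /G /=; congr (_ * _).
  by apply: eq_bigr => i _; rewrite tnthS.
have G0 z : 0 <= G z by rewrite /G mule_ge0//; apply: prode_nonneg.
rewrite fubini_tonelli1//; last first.
  apply: emeasurable_funM; first exact: (measurableT_comp (mF ord0) measurable_fst).
  exact: (measurableT_comp (mP _ (fun i => F (lift ord0 i)) (fun i => mF _)) measurable_snd).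
rewrite /fubini_F /G /=.
under eq_integral => x _.
  rewrite ge0_integralZl//; last 2 first.
  - exact: (mP _ (fun i => F (lift ord0 i)) (fun i => mF _)).
  - by move=> y _; apply: prode_nonneg.
  rewrite (IH (fun i => F (lift ord0 i)))//.
  over.
rewrite ge0_integralZr// ?big_ord_recl//.
  by apply: prode_nonneg => i _; exact: integral_ge0.
exact: measurable_cons_pair.
Qed.

End tonelli_for_tuples.

(** * Euclidean distance, balls and measurability *)

Section euclidean_distance.
Context {R : realType} {n : nat}.
Implicit Types (x y z c : euclid R n) (r : R).

Lemma eucl_dist_ge0 x y : 0 <= eucl_dist x y.
Proof. exact: sqrtr_ge0. Qed.

Lemma eucl_distC x y : eucl_dist x y = eucl_dist y x.
Proof.
by congr Num.sqrt; apply: eq_bigr => i _; rewrite -sqrrN opprB.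
Qed.

Lemma coord_le_eucl_dist x y i : `|tnth x i - tnth y i| <= eucl_dist x y.
Proof.
rewrite -sqrtr_sqr; apply: ler_wsqrtr; rewrite (bigD1 i)//= lerDl.
by apply: sumr_ge0 => j _; exact: sqr_ge0.
Qed.

Lemma sum_sqr_le (I : finType) (a : I -> R) : (forall i, 0 <= a i) ->
  \sum_i a i ^+ 2 <= (\sum_i a i) ^+ 2.
Proof.
move=> a0; rewrite [leRHS]expr2 mulr_suml; apply: ler_sum => i _.
rewrite expr2 ler_wpM2l// (bigD1 i)//= lerDl; exact: sumr_ge0.
Qed.

Lemma eucl_dist_le_sum x y :
  eucl_dist x y <= \sum_(i < n) `|tnth x i - tnth y i|.
Proof.
have S0 : 0 <= \sum_(i < n) `|tnth x i - tnth y i| by exact: sumr_ge0.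
rewrite -[leRHS](ger0_norm S0) -sqrtr_sqr; apply: ler_wsqrtr.
apply: le_trans (sum_sqr_le _) => //.
by under [leRHS]eq_bigr => i _ do rewrite real_normK ?num_real//.
Qed.

Lemma cauchy_schwarz_sum (a b : 'I_n -> R) :
  \sum_i a i * b i <= Num.sqrt (\sum_i a i ^+ 2) * Num.sqrt (\sum_i b i ^+ 2).
Proof.
have s0 (e : 'I_n -> R) : 0 <= \sum_i e i ^+ 2.
  by apply: sumr_ge0 => i _; exact: sqr_ge0.
have z (e : 'I_n -> R) : Num.sqrt (\sum_i e i ^+ 2) = 0 -> forall i, e i = 0.
  move=> /eqP; rewrite sqrtr_eq0 => e0 i; apply/eqP; rewrite -sqrf_eq0; apply/eqP.
  apply: (psumr_eq0P (P := predT) (F := fun i => e i ^+ 2)) => //.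
  - by move=> j _; exact: sqr_ge0.
  - by apply/eqP; rewrite eq_le e0 s0.
set A := Num.sqrt _; set B := Num.sqrt _.
have [A0|A0] := eqVneq A 0.
  by rewrite A0 mul0r big1// => i _; rewrite (z _ A0) mul0r.
have [B0|B0] := eqVneq B 0.
  by rewrite B0 mulr0 big1// => i _; rewrite (z _ B0) mulr0.
have Ap : 0 < A by rewrite lt0r A0 sqrtr_ge0.
have Bp : 0 < B by rewrite lt0r B0 sqrtr_ge0.
have -> : A * B = \sum_i (a i ^+ 2 * (B / A) + b i ^+ 2 * (A / B)) / 2.
  rewrite -mulr_suml big_split/= -!mulr_suml -(sqr_sqrtr (s0 a)) -(sqr_sqrtr (s0 b)).
  rewrite -/A -/B; field.
  by rewrite A0 B0.
apply: ler_sum => i _.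
rewrite -subr_ge0.
have -> : (a i ^+ 2 * (B / A) + b i ^+ 2 * (A / B)) / 2 - a i * b i =
  (a i * B - b i * A) ^+ 2 / (2 * A * B).
  by field; rewrite A0 B0.
by rewrite divr_ge0 ?sqr_ge0// ?mulr_ge0// ltW.
Qed.

Lemma eucl_dist_triangle y x z : eucl_dist x z <= eucl_dist x y + eucl_dist y z.
Proof.
have P0 := addr_ge0 (eucl_dist_ge0 x y) (eucl_dist_ge0 y z).
rewrite -[leRHS](ger0_norm P0) -sqrtr_sqr; apply: ler_wsqrtr.
have s0 (u v : euclid R n) : 0 <= \sum_i (tnth u i - tnth v i) ^+ 2.
  by apply: sumr_ge0 => i _; exact: sqr_ge0.
rewrite sqrrD !sqr_sqrtr//.
have := cauchy_schwarz_sum (fun i => tnth x i - tnth y i) (fun i => tnth y i - tnth z i).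
rewrite -/(eucl_dist x y) -/(eucl_dist y z) => /(ler_wMn2r 2) H.
apply: (@le_trans _ _ (\sum_i (tnth x i - tnth y i) ^+ 2 +
  (\sum_i (tnth x i - tnth y i) * (tnth y i - tnth z i)) *+ 2 +
  \sum_i (tnth y i - tnth z i) ^+ 2)); last by rewrite lerD2r lerD2l.
rewrite -sumrMnl -!big_split/=; apply: ler_sum => i _.
by rewrite -subr_ge0 [leRHS](_ : _ = 0)//; ring.
Qed.

End euclidean_distance.

Section measurability_of_distance.
Context {R : realType} {n : nat}.
Implicit Types (x y z c : euclid R n) (r : R).

Lemma measurable_fun_eucl_dist d (S : measurableType d) (f g : S -> euclid R n) :
  measurable_fun setT f -> measurable_fun setT g ->
  measurable_fun setT (fun s => eucl_dist (f s) (g s)).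
Proof.
move=> mf mg.
rewrite (_ : (fun _ => _) = (fun s =>
    (\sum_(i < n) (tnth (f s) i - tnth (g s) i) ^+ 2) `^ 2^-1)); last first.
  apply/funext => s; rewrite powR12_sqrt//.
  by apply: sumr_ge0 => i _; exact: sqr_ge0.
apply: (measurableT_comp (measurable_powR 2^-1)).
apply: (@measurable_sum _ _ _ _ _ _ (fun i s => (tnth (f s) i - tnth (g s) i) ^+ 2)) => i.
apply: (measurable_funX 2); apply: measurable_funB.
- exact: (measurableT_comp (measurable_tnth i) mf).
- exact: (measurableT_comp (measurable_tnth i) mg).
Qed.

Lemma measurable_eball c r : measurable (eball c r).
Proof.
have mf := @measurable_fun_eucl_dist _ _ (cst c) id (measurable_cst c) (@measurable_id _ _ _).
have := @measurable_fun_ltr _ _ _ setT _ (cst r) mf (measurable_cst r).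
by move=> /(_ measurableT [set true] I); rewrite setTI; exact.
Qed.

Lemma measurable_eucl_box (A : 'I_n -> set R) : (forall i, measurable (A i)) ->
  measurable [set x : euclid R n | forall i, A i (tnth x i)].
Proof.
move=> mA; rewrite (_ : [set _ | _] =
    \bigcap_(i in setT) ((fun x : euclid R n => tnth x i) @^-1` A i)).
  apply: fin_bigcap_measurable => // i _.
  rewrite -[X in measurable X]setTI.
  exact: (@measurable_tnth _ (measurableTypeR R) n i measurableT _ (mA i)).
by apply/seteqP; split => t /= h i; [move=> _; exact: h|exact: h].
Qed.

(** The measure of a cube; a ball is compared with a cube inside it and with a
    cube around it. *)
Lemma leb_box c r : 0 < r ->
  leb n [set x | forall i, `|tnth x i - tnth c i| < r] = ((2 * r) ^+ n)%:E.
Proof.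
move=> r0; rewrite (_ : [set x | _] = [set x : euclid R n |
    forall i, `](tnth c i - r), (tnth c i + r)[%classic (tnth x i)]); last first.
  apply/seteqP; split => x /= H i; have := H i;
    by rewrite in_itv/= ltr_distl.
rewrite [LHS](@tuple_measure_box _ (measurableTypeR R) R lebesgue_measure n
  (fun i => `](tnth c i - r), (tnth c i + r)[%classic))//.
rewrite (eq_bigr (fun _ => (2 * r)%:E)) ?prodEFin ?prodr_const ?card_ord// => i _.
rewrite [LHS](@lebesgue_measure_itv R `](tnth c i - r), (tnth c i + r)[).
rewrite /= lte_fin ifT; last by rewrite ltrBlDr -addrA ltrDl addr_gt0.
by rewrite -EFinB; congr (_%:E); ring.
Qed.

Lemma leb_eball_le c r : 0 < r -> (leb n (eball c r) <= ((2 * r) ^+ n)%:E)%E.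
Proof.
move=> r0; rewrite -(leb_box c r0); apply: le_measure; rewrite ?inE.
- exact: measurable_eball.
- rewrite (_ : [set x | _] = [set x : euclid R n |
    forall i, [set u : R | `|u - tnth c i| < r] (tnth x i)])//.
  apply: (@measurable_eucl_box (fun i => [set u : R | `|u - tnth c i| < r])) => i.
  rewrite (_ : [set _ | _] = ball (tnth c i) r); first exact: measurable_ball.
  by apply/seteqP; split => u /=; rewrite /ball/= distrC.
- by move=> x xB i; rewrite distrC (le_lt_trans (coord_le_eucl_dist _ _ _)).
Qed.

Lemma leb_eball_ge c r : 0 < r -> (0 < n)%N ->
  (((2 * (r / n%:R)) ^+ n)%:E <= leb n (eball c r))%E.
Proof.
move=> r0 n0; have rn0 : 0 < r / n%:R by rewrite divr_gt0// ltr0n.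
rewrite -(leb_box c rn0); apply: le_measure; rewrite ?inE.
- rewrite (_ : [set x | _] = [set x : euclid R n |
    forall i, [set u : R | `|u - tnth c i| < r / n%:R] (tnth x i)])//.
  apply: (@measurable_eucl_box (fun i => [set u : R | `|u - tnth c i| < r / n%:R])) => i.
  rewrite (_ : [set _ | _] = ball (tnth c i) (r / n%:R)); first exact: measurable_ball.
  by apply/seteqP; split => u /=; rewrite /ball/= distrC.
- exact: measurable_eball.
- move=> x xB; rewrite /eball/=; apply: le_lt_trans (eucl_dist_le_sum _ _) _.
  have -> : r = \sum_(i < n) (r / n%:R).
    by rewrite sumr_const card_ord -[RHS]mulr_natr divfK// pnatr_eq0 -lt0n.
  apply: ltr_sum; last by move=> i _; rewrite distrC; exact: xB.
  by apply/hasP; exists (Ordinal n0); rewrite ?mem_index_enum.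
Qed.

Lemma eball_subset c x r s : eucl_dist c x + r <= s -> eball x r `<=` eball c s.
Proof.
move=> h y yx; rewrite /eball/=; apply: lt_le_trans h.
by apply: (le_lt_trans (eucl_dist_triangle x _ _)); rewrite ltrD2l.
Qed.

End measurability_of_distance.

Section measurability_of_lipschitz.
Context {R : realType} {n : nat}.

Lemma rational_point_dense (x : euclid R n) (e : R) : 0 < e ->
  exists q : n.-tuple rat, eucl_dist x (map_tuple (ratr : rat -> measurableTypeR R) q) < e.
Proof.
move=> e0; pose s := e / n.+1%:R.
have s0 : 0 < s by rewrite divr_gt0// ltr0n.
have h i : {q : rat | `|tnth x i - ratr q| <= s}.
  have /cid[q]: exists q : rat, ratr q \in `](tnth x i : R), (tnth x i + s)[.
    have lt_s : (tnth x i : R) < (tnth x i : R) + s by rewrite ltrDl.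
    by have [q xq] := rat_in_itvoo lt_s; exists q.
  rewrite in_itv/= => /andP[q1 q2]; exists q.
  by rewrite distrC ler_distl (ltW q2) andbT lerBlDr (le_trans (ltW q1))// lerDl ltW.
exists [tuple sval (h i) | i < n].
apply: le_lt_trans (eucl_dist_le_sum _ _) _.
apply: (@le_lt_trans _ _ (\sum_(i < n) s)).
  by apply: ler_sum => i _; rewrite tnth_map tnth_mktuple; exact: (svalP (h i)).
rewrite sumr_const card_ord -mulr_natl /s mulrCA -ltr_pdivlMl// mulVf ?gt_eqF//.
by rewrite ltr_pdivrMr ?ltr0n// mul1r ltr_nat.
Qed.

(** Hoelder continuous functions are Borel: a superlevel set is a countable union,
    over the points with rational coordinates, of measurable sets. *)
Lemma measurable_Lipschitz (delta : R) (b : euclid R n -> R) : 0 < delta ->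
  Lipschitz_space delta b -> measurable_fun setT b.
Proof.
move=> d0 [C0 bC0]; pose C := Num.max C0 1.
have C_gt0 : 0 < C by rewrite lt_max ltr01 orbT.
have bC x y : `|b x - b y| <= C * eucl_dist x y `^ delta.
  by apply: le_trans (bC0 x y) _; rewrite ler_wpM2r ?powR_ge0// le_max lexx.
move=> mT; apply: (measurability _ (RGenOInfty.measurableE R)) => //.
move=> /= _ [_ [a ->] <-]; rewrite preimage_itvoy setTI.
pose Q (q : n.-tuple rat) : euclid R n := map_tuple (ratr : rat -> measurableTypeR R) q.
rewrite [X in measurable X](_ : _ = \bigcup_(q : n.-tuple rat)
    [set x | a < b (Q q) - C * eucl_dist x (Q q) `^ delta]).
  apply: countable_bigcupT_measurable => [|q]; first exact: countableP.
  rewrite -preimage_itvoy -[X in measurable X]setTI.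
  apply: measurable_funB => //; apply: measurable_funM => //.
  apply: (measurableT_comp (measurable_powR delta)).
  exact: measurable_fun_eucl_dist.
apply/seteqP; split => x /= => [abx|[q _]]; last first.
  move=> /lt_le_trans; apply; rewrite lerBlDr -lerBlDl.
  by apply: le_trans (bC x (Q q)); rewrite distrC ler_norm.
(* At a distance from x less than this number, b moves by less than half of
   b x - a. *)
have e0 : 0 < ((b x - a) / (2 * C)) `^ delta^-1.
  by rewrite powR_gt0// divr_gt0 ?subr_gt0// mulr_gt0.
have [q xq] := rational_point_dense x e0; exists q => //=.
have : eucl_dist x (Q q) `^ delta < (b x - a) / (2 * C).
  have := gt0_ltr_powR d0; move/(_ (eucl_dist x (Q q))) => H.
  have {}H := H _ _ _ xq; rewrite -powRrM mulVf ?gt_eqF// powRr1 in H.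
    by apply: H; rewrite nnegrE ?eucl_dist_ge0// powR_ge0.
  by rewrite divr_ge0 ?subr_ge0 ?ltW// mulr_gt0.
rewrite ltr_pdivlMr ?mulr_gt0// => H.
have := bC x (Q q); rewrite ler_norml => /andP[_ H2].
rewrite -/(Q q); lra.
Qed.

End measurability_of_lipschitz.

(** * The Riesz kernel *)

Section riesz_kernel.
Context {R : realType} {n : nat}.
Implicit Types (x y c : euclid R n) (r : R).

Lemma geometric_nneseries_le (a q : R) : 0 <= a -> 0 < q < 1 ->
  (\sum_(k <oo) (a * q ^+ k)%:E <= (a / (1 - q))%:E)%E.
Proof.
move=> a0 /andP[q0 q1].
have F0 k : (0 <= (a * q ^+ k)%:E)%E by rewrite lee_fin mulr_ge0// exprn_ge0// ltW.
apply: lime_le; first by apply: is_cvg_nneseries => k _ _; exact: F0.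
apply: nearW => k; rewrite sumEFin lee_fin.
by apply: (@geometric_le_lim R k a q a0 q0); rewrite ger0_norm ?ltW.
Qed.

Lemma dyadic_scale (d r : R) : 0 < d < r ->
  exists k, r / 2 ^+ k.+1 <= d < r / 2 ^+ k.
Proof.
move=> /andP[d0 dr].
have p2 k : 0 < (2 : R) ^+ k by rewrite exprn_gt0.
have ex : exists k, r / 2 ^+ k.+1 <= d.
  exists (Num.bound (r / d)); rewrite ler_pdivrMr// mulrC -ler_pdivrMr//.
  have h : r / d < (Num.bound (r / d))%:R.
    by apply: archi_boundP; rewrite divr_ge0 ?ltW// (lt_trans d0).
  apply: (le_trans (ltW h)); rewrite -natrX ler_nat.
  by rewrite (leq_trans (ltnW (ltn_expl _ (ltnSn 1))))// leq_exp2l.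
have := ex_minnP ex => -[k hk kmin]; exists k; rewrite hk/=.
case: k hk kmin => [|k] hk kmin; first by rewrite expr0 divr1.
by rewrite ltNge; apply/negP => /kmin; rewrite ltnn.
Qed.

(** The kernel [|x - y| ^ (- a)] is integrable near the diagonal for [a < n];
    the domain is cut into dyadic annuli. *)
Lemma integral_eucl_dist_powR (a : R) : 0 < a < n%:R -> exists C : R, 0 < C /\
  forall x r, 0 < r ->
  (\int[leb n]_(y in eball x r) (eucl_dist x y `^ (- a))%:E <=
   (C * r `^ (n%:R - a))%:E)%E.
Proof.
move=> /andP[a0 an]; pose q : R := 2^-1 `^ (n%:R - a).
have na0 : 0 < n%:R - a by rewrite subr_gt0.
have q01 : 0 < q < 1.
  rewrite powR_gt0//=.
  have : (2^-1 : R) `^ (n%:R - a) < 1 `^ (n%:R - a).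
    by apply: gt0_ltr_powR => //; rewrite ?nnegrE ?invr_ge0 ?invf_lt1 ?ltr1n.
  by rewrite powR1.
have q1 : 0 < 1 - q by rewrite subr_gt0; case/andP: q01.
exists (2 `^ a * 2 ^+ n / (1 - q)); split.
  by rewrite divr_gt0// mulr_gt0 ?powR_gt0 ?exprn_gt0.
move=> x r r0.
pose t k : R := r / 2 ^+ k.
have t0 k : 0 < t k by rewrite divr_gt0// exprn_gt0.
have tS k : t k.+1 = t k / 2 by rewrite /t exprSr invfM mulrA.
(* The kernel is at most F k on the annulus t k.+1 <= |x - y| < t k. *)
pose F k y : \bar R := ((t k.+1 `^ (- a))%:E * (\1_(eball x (t k)) y)%:E)%E.
have F0 k y : (0 <= F k y)%E.
  by rewrite /F -EFinM lee_fin mulr_ge0 ?powR_ge0.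
have mB s := measurable_eball x s.
have mI k : measurable_fun (eball x r) (fun y => (\1_(eball x (t k)) y)%:E : \bar R).
  exact/measurable_EFinP/measurable_indic.
have mF k : measurable_fun (eball x r) (F k).
  by apply: emeasurable_funM => //; exact: measurable_cst.
have mk : measurable_fun (eball x r) (fun y => (eucl_dist x y `^ (- a))%:E : \bar R).
  apply/measurable_EFinP; apply: measurable_funS measurableT _ _ => //.
  apply: (measurableT_comp (measurable_powR (- a))).
  exact: (measurable_fun_eucl_dist (measurable_cst x) (@measurable_id _ _ _)).
apply: (@le_trans _ _ (\int[leb n]_(y in eball x r) \sum_(k <oo) F k y)%E).
  apply: ge0_le_integral => //.
  - by move=> y _; rewrite lee_fin powR_ge0.
  - exact: ge0_emeasurable_sum.
  - move=> y xy; have [d0|d0] := eqVneq (eucl_dist x y) 0.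
      by rewrite d0 powR0 ?oppr_eq0 ?gt_eqF//; exact: nneseries_ge0.
    have dp : 0 < eucl_dist x y by rewrite lt0r d0 eucl_dist_ge0.
    have [k /andP[k1 k2]] : exists k, t k.+1 <= eucl_dist x y < t k.
      by apply: dyadic_scale; rewrite dp.
    apply: (@le_trans _ _ (F k y)).
      rewrite /F indicE mem_set// mule1 lee_fin !powRN lef_pV2 ?posrE ?powR_gt0//.
      by rewrite ge0_ler_powR// ?ltW// nnegrE ltW.
    have := @nneseries_lim_ge R (F ^~ y) xpredT 0 k.+1 (fun k _ _ => F0 k y).
    rewrite big_nat_recr//=; apply: le_trans.
    by rewrite leeDr//; exact: sume_ge0.
rewrite integral_nneseries//.
apply: (@le_trans _ _ (\sum_(k <oo) (2 `^ a * 2 ^+ n * r `^ (n%:R - a) * q ^+ k)%:E)%E).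
  apply: lee_nneseries => [k _ _|k _]; first by apply: integral_ge0.
  rewrite ge0_integralZl_EFin ?powR_ge0//.
  rewrite integral_indic//.
  apply: (@le_trans _ _ ((t k.+1 `^ (- a))%:E * ((2 * t k) ^+ n)%:E)%E).
    apply: lee_wpmul2l; first by rewrite lee_fin powR_ge0.
    apply: le_trans (leb_eball_le x (t0 k)).
    by apply: le_measure; rewrite ?inE//; exact: measurableI.
  have tk0 := ltW (t0 k); have r0' := ltW r0.
  rewrite -EFinM lee_fin tS powRM ?invr_ge0// -powR_inv1// -powRrM mulN1r opprK.
  rewrite exprMn -(powR_mulrn n (ltW (t0 k))).
  have -> : t k `^ (- a) * 2 `^ a * (2 ^+ n * t k `^ n%:R) =
      2 `^ a * 2 ^+ n * (t k `^ n%:R * t k `^ (- a)) by ring.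
  rewrite -powRD ?gt_eqF ?implybT//.
  rewrite /t powRM ?invr_ge0 ?exprn_ge0// /q.
  rewrite -exprVn -(powR_mulrn k (a := _ `^ _)) ?powR_ge0//.
  by rewrite -(powR_mulrn k (a := 2^-1)) ?invr_ge0// powRAC !mulrA.
 have K0 : 0 <= 2 `^ a * 2 ^+ n * r `^ (n%:R - a).
  by rewrite !mulr_ge0 ?powR_ge0 ?exprn_ge0.
apply: (le_trans (geometric_nneseries_le K0 q01)).
by rewrite lee_fin le_eqVlt; apply/orP; left; apply/eqP; ring.
Qed.

End riesz_kernel.

(** * Mean oscillation *)

Section mean_oscillation.
Context d (T : measurableType d) (R : realType).
Variable mu : {measure set T -> \bar R}.
Implicit Types (B : set T) (F : T -> R) (N : T -> \bar R) (A : R).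

Lemma ae_nonempty (B : set T) (P : T -> Prop) : measurable B -> (0 < mu B)%E ->
  {ae mu, forall x, P x} -> exists x, B x /\ P x.
Proof.
move=> mB B0 [M [mM M0 MP]]; apply: contrapT => nex.
have BM : B `<=` M.
  by move=> x Bx; apply: MP => /= Px; apply: nex; exists x.
by move: B0; rewrite ltNge -M0 le_measure// inE.
Qed.

(** If the difference of two values of [F] is controlled by a sum of values of
    an integrable function, then so is the mean oscillation of [F]. *)
Lemma mean_oscillation_le B F N A (G : T -> Prop) :
  measurable B -> (0 < mu B)%E -> (mu B < +oo)%E ->
  measurable_fun setT F -> measurable_fun setT N -> (forall x, 0 <= N x)%E ->
  0 <= A -> (\int[mu]_(x in B) N x < +oo)%E -> {ae mu, forall x, G x} ->
  (forall x z, G x -> G z -> B x -> B z ->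
    (`|F x - F z|%:E <= N x + N z + A%:E)%E) ->
  mu.-integrable B (EFin \o F) /\
  (\int[mu]_(x in B) (`|F x - (fine (mu B))^-1 * \int[mu]_(z in B) F z|)%:E <=
   2%:E * \int[mu]_(x in B) N x + A%:E * mu B)%E.
Proof.
move=> mB B0 Boo mF mN N0 A0 Noo aeG FN.
have mBf : mu B = (fine (mu B))%:E by rewrite fineK// ge0_fin_numE.
set V := fine (mu B); have V0 : 0 < V by rewrite /V fine_gt0// B0.
have mNB : measurable_fun B N by exact: measurable_funTS.
have iN : mu.-integrable B N.
  by apply/integrableP; split => //; under eq_integral do rewrite gee0_abs//.
have aeN := integrable_ae mB iN.
(* A base point at which N is finite bounds F by an integrable function. *)
have [z [Bz [Gz /(_ Bz) Nz]]] : exists z, B z /\ (G z /\ (B z -> N z \is a fin_num)).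
  by apply: ae_nonempty => //; apply: filterS2 aeG aeN => x ? ?; split.
have mFB : measurable_fun B F by exact: measurable_funTS.
have cst_int (k : R) : (\int[mu]_(x in B) k%:E = (k * V)%:E)%E.
  by rewrite integral_cst// mBf.
have iF : mu.-integrable B (EFin \o F).
  apply/integrableP; split; first exact/measurable_EFinP.
  apply: (@le_lt_trans _ _ (\int[mu]_(x in B) (N x + (fine (N z) + A + `|F z|)%:E))%E).
    apply: ae_ge0_le_integral => //.
    - by apply: measurableT_comp => //; exact/measurable_EFinP.
    - by move=> x _; rewrite adde_ge0// lee_fin !addr_ge0// fine_ge0.
    - exact: emeasurable_funD.
    - apply: filterS aeG => x Gx Bx.
      rewrite [leLHS](_ : _ = `|F x|%:E)//.
      apply: (@le_trans _ _ (`|F x - F z|%:E + `|F z|%:E)%E).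
        by rewrite -EFinD lee_fin -[X in `|X|](subrK (F z)) ler_normD.
      rewrite !EFinD !addeA; apply: leeD2r.
      by have := FN x z Gx Gz Bx Bz; rewrite fineK// addeA.
  rewrite ge0_integralD//; last by move=> x _; rewrite lee_fin !addr_ge0// fine_ge0.
  by rewrite cst_int lte_add_pinfty// ltry.
split => //.
set I := (\int[mu]_(x in B) N x)%E in Noo *.
have I0 : (0 <= I)%E by exact: integral_ge0.
have If : I = (fine I)%:E by rewrite fineK// ge0_fin_numE.
have fI0 : 0 <= fine I by exact: fine_ge0.
apply: (@le_trans _ _ (\int[mu]_(x in B) (N x + (A + V^-1 * fine I)%:E))%E); last first.
  rewrite ge0_integralD//; last first.
    by move=> x _; rewrite lee_fin addr_ge0// mulr_ge0// invr_ge0 ltW.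
  rewrite cst_int -/I If mBf -/V -!EFinM -!EFinD lee_fin.
  by rewrite mulrDl mulrAC mulVf ?gt_eqF// mul1r; lra.
apply: ae_ge0_le_integral => //.
- by apply/measurable_EFinP; apply: measurableT_comp => //; exact: measurable_funB.
- by move=> x _; rewrite adde_ge0// lee_fin addr_ge0// mulr_ge0// invr_ge0 ltW.
- exact: emeasurable_funD.
apply: filterS2 (aeG) (aeN) => x Gx Nxf Bx; have {}Nxf := Nxf Bx.
have icst : mu.-integrable B (EFin \o cst (F x)).
  apply/integrableP; split; first by apply/measurable_EFinP; exact: measurable_cst.
  by rewrite (eq_integral (cst `|F x|%:E)) ?integral_cst//= mBf -EFinM ltry.
have -> : F x - V^-1 * \int[mu]_(z in B) F z = V^-1 * \int[mu]_(z in B) (F x - F z).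
  rewrite RintegralB// Rintegral_cst// -/V mulrBr mulrCA mulVf ?mulr1// gt_eqF//.
have iD : mu.-integrable B (EFin \o (fun z => F x - F z)) := integrableB mB icst iF.
rewrite normrM [X in X * _]ger0_norm ?invr_ge0 ?(ltW V0)//.
apply: (@le_trans _ _ (V^-1%:E * \int[mu]_(z in B) (`|F x - F z|)%:E)%E).
  rewrite EFinM; apply: lee_wpmul2l; first by rewrite lee_fin invr_ge0 ltW.
  rewrite -(@fineK _ (\int[mu]_(z in B) _)%E); last first.
    apply: integrable_fin_num => //; exact: (integrable_norm iD).
  by rewrite lee_fin; exact: le_normr_Rintegral.
rewrite lee_pdivrMl//.
apply: (@le_trans _ _ (\int[mu]_(z in B) (N z + (fine (N x) + A)%:E))%E).
  apply: ae_ge0_le_integral => //.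
  - apply/measurable_EFinP; apply: measurableT_comp => //; exact: measurable_funB.
  - by move=> y _; rewrite adde_ge0// lee_fin addr_ge0// fine_ge0.
  - exact: emeasurable_funD.
  - apply: filterS aeG => y Gy By; apply: le_trans (FN _ _ Gx Gy Bx By) _.
    by rewrite EFinD fineK// addeA (addeC (N x)).
rewrite ge0_integralD//; last by move=> y _; rewrite lee_fin addr_ge0// fine_ge0.
rewrite cst_int -/I If -(fineK Nxf) -!EFinD -EFinM lee_fin !mulrDr mulrA divff ?gt_eqF//.
by rewrite mul1r; lra.
Qed.

End mean_oscillation.

(** * Factorization of functions and of weights *)

Section weighted_factors.
Context d (T : measurableType d) (R : realType).
Variable mu : {measure set T -> \bar R}.
Hypothesis muT : (0 < mu [set: T])%E.
Implicit Types (f g h : T -> R) (p : \bar R).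

Lemma ess_sup_mul_le f g : measurable_fun setT f -> measurable_fun setT g ->
  ('N[mu]_+oo[EFin \o f] < +oo)%E ->
  (\int[mu]_x `|f x * g x|%:E <=
   'N[mu]_+oo[EFin \o f] * 'N[mu]_1[EFin \o g])%E.
Proof.
move=> mf mg; rewrite Lnorm1 => Noo; set M := ('N[mu]_+oo[_])%E in Noo *.
have M0 : (0 <= M)%E by exact: Lnorm_ge0.
have aeM : {ae mu, forall x, (`|f x|%:E <= M)%E}.
  rewrite /M unlock muT; exact: (@ess_sup_ge _ _ _ mu (abse \o (EFin \o f))).
rewrite -(@fineK _ M) ?ge0_fin_numE//.
rewrite -ge0_integralZl_EFin//; last 2 first.
- by apply: measurableT_comp => //; exact/measurable_EFinP.
- exact: fine_ge0.
apply: ae_ge0_le_integral => //.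
- by apply/measurable_EFinP; apply: measurableT_comp => //; exact: measurable_funM.
- by move=> x _; rewrite mule_ge0// lee_fin fine_ge0.
- apply: emeasurable_funM => //.
  by apply: measurableT_comp => //; exact/measurable_EFinP.
- apply: filterS aeM => x fM _; rewrite normrM EFinM /=.
  by apply: lee_wpmul2r => //; rewrite fineK// ge0_fin_numE.
Qed.

(** Hoelder's inequality, endpoint exponents included. *)
Lemma integral_norm_mul_le f g p : (1 <= p)%E ->
  measurable_fun setT f -> measurable_fun setT g ->
  ('N[mu]_p[EFin \o f] < +oo)%E ->
  ('N[mu]_(hoelder_conjugate p)[EFin \o g] < +oo)%E ->
  (\int[mu]_x `|f x * g x|%:E <=
   'N[mu]_p[EFin \o f] * 'N[mu]_(hoelder_conjugate p)[EFin \o g])%E.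
Proof.
move=> p1 mf mg Nf Ng.
have [py|py] := eqVneq p +oo%E.
  by move: Nf Ng; rewrite py hoelder_conjugatey => Nf Ng; exact: ess_sup_mul_le.
have [pe1|p_neq1] := eqVneq p 1%E.
  move: Nf Ng; rewrite pe1 hoelder_conjugate1 => Nf Ng.
  under eq_integral => x _ do rewrite mulrC.
  by rewrite muleC; exact: ess_sup_mul_le.
case: p => [r| |] in p1 Nf Ng py p_neq1 *; [|by rewrite eqxx in py|by []].
have r1 : 1 < r by rewrite lt_neqAle -lee_fin p1 andbT eq_sym; apply: contra p_neq1 => /eqP ->.
have r0 : 0 < r by exact: lt_trans r1.
have qE : hoelder_conjugate r%:E = (r / (r - 1))%:E.
  rewrite /hoelder_conjugate/= gt_eqF ?lte_fin// -EFinD inver gt_eqF ?subr_gt0//.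
rewrite qE in Ng *.
have := @hoelder _ _ _ mu f g r (r / (r - 1)) mf mg r0.
rewrite divr_gt0 ?subr_gt0// => /(_ isT).
have -> : r^-1 + (r / (r - 1))^-1 = 1.
  by rewrite invf_div; field; rewrite gt_eqF//= gt_eqF// subr_gt0.
by move=> /(_ erefl); rewrite Lnorm1.
Qed.

(** A function of [L^p] is its norm times the power [1 / p] of an integrable
    function of integral at most one; for [p = +oo] the power is [0 `^ 0 = 1]. *)
Lemma Lnorm_factorization h p : (1 <= p)%E -> measurable_fun setT h ->
  ('N[mu]_p[EFin \o h] < +oo)%E ->
  exists H : T -> R, [/\ measurable_fun setT H, forall x, 0 <= H x,
    (\int[mu]_x (H x)%:E <= 1)%E &
    {ae mu, forall x, `|h x| <= fine ('N[mu]_p[EFin \o h])%E * H x `^ fine p^-1}].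
Proof.
move=> p1 mh; set M := ('N[mu]_p[_])%E => Noo.
have M0 : (0 <= M)%E by exact: Lnorm_ge0.
have MK : (fine M)%:E = M by rewrite fineK// ge0_fin_numE.
have [py|py] := eqVneq p +oo%E.
  exists (cst 0); split => //; first by rewrite integral0_eq ?lee01.
  have : {ae mu, forall x, (`|h x|%:E <= M)%E}.
    rewrite /M py unlock muT; exact: (@ess_sup_ge _ _ _ mu (abse \o (EFin \o h))).
  apply: filterS => x; rewrite py invey /= powRr0 mulr1 -MK lee_fin.
  exact.
case: p => [r| |] in p1 @M Noo M0 MK py *; [|by rewrite eqxx in py|by []].
have r0 : 0 < r by rewrite (@lt_le_trans _ _ 1)// -lee_fin.
rewrite inver gt_eqF//=.
have [Me0|Mn0] := eqVneq M 0%E.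
  exists (cst 0); split => //; first by rewrite integral0_eq ?lee01.
  have mEh : measurable_fun setT (EFin \o h) by exact/measurable_EFinP.
  have := Lnorm_eq0_eq0 mEh _ Me0; rewrite lte_fin => /(_ r0).
  apply: filterS => x /(_ I) /= [->]; rewrite normr0 Me0 mul0r//.
have fM0 : 0 < fine M by rewrite fine_gt0// lt0e Mn0 M0.
exists (fun x => (`|h x| / fine M) `^ r).
have mH : measurable_fun setT (fun x => (`|h x| / fine M) `^ r).
  apply: (measurableT_comp (measurable_powR r)); apply: measurable_funM => //.
  exact: measurableT_comp.
split => //.
- by move=> x; exact: powR_ge0.
- under eq_integral => x _ do rewrite powRM ?invr_ge0// ?ltW// EFinM.
  have mhr : measurable_fun setT (fun x => (`|h x| `^ r)%:E).
    apply/measurable_EFinP; apply: (measurableT_comp (measurable_powR r)).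
    exact: measurableT_comp.
  rewrite (ge0_integralZr mu measurableT mhr) ?lee_fin ?powR_ge0//.
  have -> : (\int[mu]_x (`|h x| `^ r)%:E = (fine M `^ r)%:E)%E.
    by rewrite -poweR_EFin MK /M poweR_Lnorm ?gt_eqF//.
  by rewrite -EFinM -powRM ?invr_ge0 ?(ltW fM0)// divff ?gt_eqF// powR1.
- apply: aeW => x; rewrite -powRrM divff ?gt_eqF// powRr1; last first.
    by rewrite divr_ge0// ltW.
  by rewrite mulrCA divff ?gt_eqF// mulr1.
Qed.

End weighted_factors.

Section reverse_hoelder_factorization.
Context {R : realType} {n : nat}.
Hypothesis n0 : (0 < n)%N.
Implicit Types (v f phi : euclid R n -> R) (c : euclid R n) (p : \bar R).

Lemma leb_eball_gt0 c (r : R) : 0 < r -> (0 < leb n (eball c r))%E.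
Proof.
move=> r0; apply: lt_le_trans (leb_eball_ge c r0 n0).
by rewrite lte_fin exprn_gt0// mulr_gt0// divr_gt0// ltr0n.
Qed.

Lemma leb_eball_lty c (r : R) : 0 < r -> (leb n (eball c r) < +oo)%E.
Proof. by move=> r0; apply: (le_lt_trans (leb_eball_le c r0)); rewrite ltry. Qed.

Lemma leb_eball_fineK c (r : R) : 0 < r ->
  (fine (leb n (eball c r)))%:E = leb n (eball c r).
Proof. by move=> r0; rewrite fineK// ge0_fin_numE// leb_eball_lty. Qed.

Lemma fine_leb_eball_gt0 c (r : R) : 0 < r -> 0 < fine (leb n (eball c r)).
Proof. by move=> r0; rewrite -lte_fin leb_eball_fineK// leb_eball_gt0. Qed.

Lemma leb_setT_gt0 : (0 < leb n [set: euclid R n])%E.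
Proof.
have c : euclid R n := nseq_tuple n (0 : R).
apply: (@lt_le_trans _ _ (leb n (eball c 1))); first exact: leb_eball_gt0.
by apply: le_measure; rewrite ?inE//; exact: measurable_eball.
Qed.

Lemma hoelder_conjugate_fin p : (1 < p)%E -> exists q : R,
  [/\ 1 <= q, hoelder_conjugate p = q%:E & 1 - fine p^-1 = q^-1].
Proof.
case: p => [r| |]// p1; last by exists 1; rewrite hoelder_conjugatey invey/= subr0 invr1.
have r1 : 1 < r by rewrite -lte_fin.
have r0 : 0 < r by exact: lt_trans r1.
exists (r / (r - 1)); split.
- by rewrite ler_pdivlMr ?subr_gt0// mul1r lerBlDr lerDl.
- rewrite /hoelder_conjugate/= gt_eqF ?lte_fin//.
  by rewrite -EFinD inver gt_eqF ?subr_gt0.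
- by rewrite inver gt_eqF//= invf_div mulrBl divff ?gt_eqF// mul1r.
Qed.

Lemma measurable_weight v : weight v -> measurable_fun setT v.
Proof. by move=> [[]]. Qed.

Lemma measurable_inv d (S : measurableType d) (g : S -> R) :
  measurable_fun setT g -> measurable_fun setT (fun x => (g x)^-1).
Proof.
move=> mg.
rewrite (_ : (fun _ => _) = (fun x => g x * (`|g x| `^ (- 1)) ^+ 2)); last first.
  apply/funext => x; rewrite powR_inv1// exprVn real_normK ?num_real//.
  have [->|gx0] := eqVneq (g x) 0; first by rewrite invr0 mul0r.
  by rewrite expr2 invfM mulrA divff// mul1r.
apply: measurable_funM => //; apply: (measurable_funX 2).
apply: (measurableT_comp (measurable_powR (- 1))).
exact: measurableT_comp.
Qed.

(** On a ball the inverse of a weight is bounded by a power of a function of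
    integral at most one, by the reverse Hoelder inequality; for [p = 1] it is
    essentially bounded and the power is [0]. *)
Lemma inverse_weight_factorization v p m : weight v -> (1 <= p)%E -> (0 < m)%N ->
  ((1 < p)%E -> (1 < m)%N ->
    reverse_holder m%:R (fun x => v x `^ (- fine (hoelder_conjugate p)))) ->
  exists C : R, 0 < C /\ forall c (s L : R) phi, 0 < s -> 0 < L ->
    measurable_fun setT phi ->
    {ae leb n, forall x, eball c s x -> (v x)^-1 <= L * phi x} ->
    (0 < 'N[leb n]_(hoelder_conjugate p)[EFin \o phi])%E ->
    ('N[leb n]_(hoelder_conjugate p)[EFin \o phi] < +oo)%E ->
  exists U : euclid R n -> R, [/\ measurable_fun setT U, forall x, 0 <= U x,
    (\int[leb n]_x (U x)%:E <= 1)%E &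
    {ae leb n, forall x, eball c s x ->
      (v x)^-1 <= C *
        (L * fine ('N[leb n]_(hoelder_conjugate p)[EFin \o phi])%E) *
        fine (leb n (eball c s)) `^ (- ((1 - fine p^-1) * (1 - m%:R^-1))) *
        U x `^ ((1 - fine p^-1) / m%:R)}].
Proof.
move=> wv p1 m0 rh; have mv := measurable_weight wv.
have [_ v_gt0] := wv.
move: p1; rewrite le_eqVlt => /predU1P[pe|p1].
  exists 1; split => // c s L phi s0 L0 mphi vphi; rewrite -pe.
  rewrite hoelder_conjugate1; set M := 'N[_]_ _[_]%E => M0 Moo.
  exists (cst 0); split => //; first by rewrite integral0_eq ?lee01.
  have : {ae leb n, forall x, (`|phi x|%:E <= M)%E}.
    rewrite /M unlock leb_setT_gt0.
    exact: (@ess_sup_ge _ _ _ (leb n) (abse \o (EFin \o phi))).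
  apply: filterS2 (vphi) => x vx Hx xB; rewrite inve1/= subrr !mul0r oppr0 !powRr0 !mulr1 mul1r.
  apply: (le_trans (vx xB)); rewrite ler_pM2l//.
  apply: (le_trans (ler_norm _)); rewrite -lee_fin fineK// ge0_fin_numE//; exact: ltW.
have [q [q1 qE tauE]] := hoelder_conjugate_fin p1.
have q0 : 0 < q by exact: lt_le_trans q1.
rewrite qE/= in rh *; rewrite tauE.
have m0' : 0 < m%:R :> R by rewrite ltr0n.
(* The reverse Hoelder inequality, also for m = 1 where it is an equality. *)
have [C [C0 HC]] : exists C, 0 < C /\ forall c s (I1 : R), 0 < s -> 0 < I1 ->
    let V := fine (leb n (eball c s)) in
    (\int[leb n]_(x in eball c s) (v x `^ (- q))%:E <= I1%:E)%E ->
    (\int[leb n]_(x in eball c s) ((v x `^ (- q)) `^ m%:R)%:E <=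
      (V * (C * (V^-1 * I1)) `^ m%:R)%:E)%E.
  have [m1|m1] := leqP m 1%N.
    have {m1}-> : m = 1%N by apply/eqP; rewrite eqn_leq m1.
    exists 1; split=> // c s I1 s0 I10 V HI1.
    have V0 : 0 < V by exact: fine_leb_eball_gt0.
    rewrite powRr1 ?mul1r ?mulr_ge0 ?invr_ge0 ?(ltW V0) ?(ltW I10)//.
    rewrite mulrA divff ?gt_eqF// mul1r.
    by under eq_integral do rewrite powRr1 ?powR_ge0//.
  have [_ [C0 HC0]] := rh p1 m1.
  pose C := Num.max C0 1; have Cp : 0 < C by rewrite lt_max ltr01 orbT.
  exists C; split => // c s I1 s0 I10 V HI1.
  have V0 : 0 < V by exact: fine_leb_eball_gt0.
  have := HC0 c s s0; rewrite /= -(leb_eball_fineK c s0) -/V.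
  set J := (\int[leb n]_(x in _) _)%E; set I := (\int[leb n]_(x in _) _)%E.
  have J0 : (0 <= J)%E by apply: integral_ge0 => x _; rewrite lee_fin powR_ge0.
  have I0 : (0 <= I)%E by apply: integral_ge0 => x _; rewrite lee_fin powR_ge0.
  rewrite inver gt_eqF// => H.
  have {}H : (((V^-1)%:E * J) `^ m%:R^-1 <= (C * (V^-1 * I1))%:E)%E.
    apply: (le_trans H); rewrite !EFinM.
    apply: (@le_trans _ _ (C%:E * ((V^-1)%:E * I))%E).
      apply: lee_wpmul2r; first by rewrite mule_ge0// lee_fin invr_ge0 ltW.
      by rewrite lee_fin le_max lexx.
    apply: lee_wpmul2l; first by rewrite lee_fin ltW.
    by apply: lee_wpmul2l => //; rewrite lee_fin invr_ge0 ltW.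
  have VJ0 : (0 <= (V^-1)%:E * J)%E.
    by apply: mule_ge0; [rewrite lee_fin invr_ge0; exact: ltW|exact: J0].
  have P0 : 0 <= C * (V^-1 * I1) by rewrite !mulr_ge0 ?invr_ge0// ltW.
  have {}H : ((V^-1)%:E * J <= ((C * (V^-1 * I1)) `^ m%:R)%:E)%E.
    have {}H := gt0_ler_poweR (ltW m0') _ _ H; move: H.
    rewrite !in_itv/= !leey !andbT poweR_ge0 lee_fin P0 => /(_ isT isT).
    by rewrite -poweRrM mulVf ?gt_eqF// poweRe1// poweR_EFin.
  by rewrite lee_pdivrMl in H.
(* The function U is v^(- q m) on the ball, divided by the upper bound A of its
   integral that the reverse Hoelder inequality provides. *)
exists (C `^ q^-1); split; first exact: powR_gt0.
move=> c s L phi s0 L0 mphi vphi; set M := 'N[_]_ _[_]%E => M0 Moo.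
have MK : (fine M)%:E = M by rewrite fineK// ge0_fin_numE// ltW.
have fM0 : 0 < fine M by rewrite -lte_fin MK.
set V := fine (leb n (eball c s)); have V0 : 0 < V by exact: fine_leb_eball_gt0.
pose I1 := (L * fine M) `^ q; have I10 : 0 < I1 by rewrite powR_gt0// mulr_gt0.
have mB : measurable (eball c s) by exact: measurable_eball.
have mvq : measurable_fun setT (fun x => v x `^ (- q)).
  exact: (measurableT_comp (measurable_powR (- q))).
have HI1 : (\int[leb n]_(x in eball c s) (v x `^ (- q))%:E <= I1%:E)%E.
  have mphiq : measurable_fun setT (fun x => (`|phi x| `^ q)%:E).
    apply/measurable_EFinP; apply: (measurableT_comp (measurable_powR q)).
    exact: measurableT_comp.
  apply: (@le_trans _ _ (\int[leb n]_(x in eball c s) ((L `^ q)%:E * (`|phi x| `^ q)%:E))%E).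
    apply: ae_ge0_le_integral => //.
    - by move=> x _; rewrite lee_fin powR_ge0.
    - by apply/measurable_EFinP; exact: measurable_funTS.
    - by move=> x _; rewrite -EFinM lee_fin mulr_ge0// powR_ge0.
    - by apply: emeasurable_funM => //; exact: measurable_funTS.
    apply: filterS2 vphi v_gt0 => x vx v0 xB.
    rewrite -EFinM lee_fin -powRM ?(ltW L0)// -[in leLHS]mulN1r powRrM powR_inv1 ?(ltW v0)//.
    apply: ge0_ler_powR; rewrite ?nnegrE ?(ltW q0) ?invr_ge0 ?(ltW v0) ?mulr_ge0 ?(ltW L0)//.
    by apply: (le_trans (vx xB)); rewrite ler_pM2l// ler_norm.
  rewrite ge0_integralZl_EFin ?powR_ge0//; last exact: measurable_funTS.
  rewrite /I1 powRM ?(ltW L0) ?(ltW fM0)// EFinM.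
  apply: lee_wpmul2l; first by rewrite lee_fin powR_ge0.
  rewrite -poweR_EFin MK /M poweR_Lnorm ?gt_eqF//.
  by apply: ge0_subset_integral => //.
set A := V * (C * (V^-1 * I1)) `^ m%:R.
have CVI0 : 0 < C * (V^-1 * I1) by rewrite !mulr_gt0 ?invr_gt0.
have A0 : 0 < A by rewrite mulr_gt0// powR_gt0.
have HA := HC c s I1 s0 I10 HI1; rewrite -/V -/A in HA.
have mvqm : measurable_fun setT (fun x => (v x `^ (- q)) `^ m%:R).
  exact: (measurableT_comp (measurable_powR m%:R)).
exists (fun x => (v x `^ (- q)) `^ m%:R / A * \1_(eball c s) x); split.
- by apply: measurable_funM => //; apply: measurable_funM.
- by move=> x; rewrite mulr_ge0// divr_ge0 ?powR_ge0// ltW.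
- rewrite (eq_integral (fun x => ((A^-1)%:E *
      (((fun x => ((v x `^ (- q)) `^ m%:R)%:E) \_ (eball c s)) x))%E)); last first.
    move=> x _; rewrite patchE indicE.
    by case: ifPn => xB; rewrite ?mulr1 ?mulr0 ?mule0// mulrC EFinM.
  have p0 x : [set: euclid R n] x ->
      (0 <= ((fun x => ((v x `^ (- q)) `^ m%:R)%:E) \_ (eball c s)) x)%E.
    by move=> _; rewrite patchE; case: ifPn => // _; rewrite lee_fin powR_ge0.
  rewrite ge0_integralZl_EFin ?invr_ge0 ?(ltW A0)//; last first.
    apply: (measurable_restrictT _ mB).1; apply: measurable_funTS.
    exact/measurable_EFinP.
  by rewrite -integral_mkcond lee_pdivrMl// mule1.
- apply: filterS v_gt0 => x v0 xB.
  rewrite indicE mem_set// mulr1 powRM ?powR_ge0 ?invr_ge0 ?(ltW A0)//.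
  have -> : ((v x `^ (- q)) `^ m%:R) `^ (q^-1 / m%:R) = (v x)^-1.
    rewrite -!powRrM (_ : _ * _ = - 1) ?powR_inv1 ?(ltW v0)//.
    by field; rewrite !gt_eqF.
  rewrite -[A^-1]powR_inv1 ?(ltW A0)// -powRrM mulN1r.
  have AE : A `^ (q^-1 / m%:R) =
      C `^ q^-1 * (L * fine M) * V `^ (- (q^-1 * (1 - m%:R^-1))).
    have LM0 : 0 < L * fine M by rewrite mulr_gt0.
    rewrite /A powRM ?powR_ge0 ?(ltW V0)// -powRrM.
    rewrite (_ : m%:R * _ = q^-1); last by field; rewrite !gt_eqF.
    rewrite !powRM ?mulr_ge0 ?invr_ge0 ?(ltW V0) ?(ltW C0) ?(ltW I10)//.
    rewrite /I1 -[(_ `^ q) `^ _]powRrM divff ?gt_eqF// powRr1 ?(ltW LM0)//.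
    rewrite -[V^-1]powR_inv1 ?(ltW V0)// -powRrM mulN1r.
    rewrite (_ : - (q^-1 * (1 - m%:R^-1)) = q^-1 / m%:R + - q^-1); last first.
      by field; rewrite !gt_eqF.
    by rewrite (@powRD _ V) ?(gt_eqF V0) ?implybT//; ring.
  by rewrite -AE powRN mulrC -mulrA mulVf ?mulr1// gt_eqF// powR_gt0.
Qed.

End reverse_hoelder_factorization.

Section ball_scale.
Context {R : realType} {n : nat}.
Hypothesis n0 : (0 < n)%N.
Implicit Types (v f : euclid R n -> R) (c z : euclid R n) (p : \bar R).

(** The quantity [|B|^(1/n) + |x_B - z|] of the class of weights, for the ball
    [B] of center [c] and radius [r]; it is comparable to [r + |c - z|]. *)
Definition ball_scale c (r : R) z : R :=
  fine (leb n (eball c r)) `^ n%:R^-1 + eucl_dist c z.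

Lemma ball_scale_gt0 c (r : R) z : 0 < r -> 0 < ball_scale c r z.
Proof.
by move=> r0; rewrite ltr_pwDl ?eucl_dist_ge0// powR_gt0// fine_leb_eball_gt0.
Qed.

Lemma ball_scale_le c (r : R) z : 0 < r -> ball_scale c r z <= 2 * r + eucl_dist c z.
Proof.
move=> r0; rewrite lerD2r.
have n0' : n%:R != 0 :> R by rewrite pnatr_eq0 -lt0n.
have -> : 2 * r = ((2 * r) ^+ n) `^ n%:R^-1.
  have r20 : 0 <= 2 * r by rewrite mulr_ge0// ltW.
  by rewrite -powR_mulrn// -powRrM divff// powRr1.
apply: ge0_ler_powR; rewrite ?invr_ge0 ?ler0n// ?nnegrE.
- by rewrite ltW// fine_leb_eball_gt0.
- by rewrite exprn_ge0// mulr_ge0// ltW.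
- by rewrite -lee_fin leb_eball_fineK// leb_eball_le.
Qed.

Lemma measurable_ball_scale c (r : R) : measurable_fun setT (ball_scale c r).
Proof.
apply: measurable_funD => //.
exact: (measurable_fun_eucl_dist (measurable_cst c) (@measurable_id _ _ _)).
Qed.

(** The two bounds on a single factor [f] that enter the estimates of the
    commutator: the first one away from the ball, the second one near it. *)
Lemma factor_bounds v p m (kappa e : R) : weight v -> (1 <= p)%E -> (0 < m)%N ->
  ((1 < p)%E -> (1 < m)%N ->
    reverse_holder m%:R (fun x => v x `^ (- fine (hoelder_conjugate p)))) ->
  1 <= kappa -> 0 < e ->
  exists C : R, 0 < C /\ forall c (r : R) f, 0 < r ->
    measurable_fun setT f -> (fun x => f x * v x) \in Lfun (leb n) p ->
    let M := ('N[leb n]_(hoelder_conjugate p)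
      [EFin \o (fun z => (v z)^-1 / ball_scale c r z `^ e)%R])%E in
    let h := fine ('N[leb n]_p[EFin \o (fun x => f x * v x)%R])%E in
    (0 < M)%E -> (M < +oo)%E ->
    (\int[leb n]_z (`|f z| / ball_scale c r z `^ e)%:E <= (h * fine M)%:E)%E /\
    exists H U : euclid R n -> R,
      [/\ measurable_fun setT H /\ measurable_fun setT U,
          (forall x, 0 <= H x) /\ (forall x, 0 <= U x),
          (\int[leb n]_x (H x)%:E <= 1)%E, (\int[leb n]_x (U x)%:E <= 1)%E &
          {ae leb n, forall z, eball c (kappa * r) z ->
            `|f z| <= C * (h * fine M) *
              r `^ (e - n%:R * (1 - fine p^-1) * (1 - m%:R^-1)) *
              (H z `^ fine p^-1 * U z `^ ((1 - fine p^-1) / m%:R))}].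
Proof.
move=> wv p1 m0 rh k1 e0; have [_ v_gt0] := wv; have mv := measurable_weight wv.
have [C0 [C0p HC0]] := inverse_weight_factorization n0 wv p1 m0 rh.
have k0 : 0 < kappa by exact: lt_le_trans k1.
set t := 1 - fine p^-1; set y := 1 - m%:R^-1 : R.
have t0 : 0 <= t.
  rewrite /t subr_ge0; case: p p1 {rh HC0 t} => [s| |] p1.
  - have s1 : 1 <= s by rewrite -lee_fin.
    have s0 : 0 < s by exact: lt_le_trans s1.
    by rewrite inver gt_eqF//= invf_le1.
  - by rewrite invey /= ler01.
  - by [].
have y0 : 0 <= y by rewrite /y subr_ge0 invf_le1 ?ler1n ?ltr0n.
pose K : R := (2 * (kappa / n%:R)) ^+ n.
have K0 : 0 < K by rewrite exprn_gt0// mulr_gt0// divr_gt0// ltr0n.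
exists (C0 * (2 + kappa) `^ e * K `^ (- (t * y))); split.
  by rewrite !mulr_gt0// powR_gt0// addr_gt0.
move=> c r f r0 mf fv; set phi := fun z => (v z)^-1 / _.
move=> M h M0 Moo.
have mrho : measurable_fun setT (fun z => (ball_scale c r z `^ e)^-1).
  apply: measurable_inv; apply: (measurableT_comp (measurable_powR e)).
  exact: measurable_ball_scale.
have mphi : measurable_fun setT phi.
  by apply: measurable_funM => //; exact: measurable_inv.
have mfv : measurable_fun setT (fun x => f x * v x) by exact: measurable_funM.
have fvoo : ('N[leb n]_p[EFin \o (fun x => f x * v x)%R] < +oo)%E.
  by have /andP[_] := fv; rewrite inE.
have hK : h%:E = ('N[leb n]_p[EFin \o (fun x => f x * v x)%R])%E.
  by rewrite fineK// ge0_fin_numE// Lnorm_ge0.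
have MK : (fine M)%:E = M by rewrite fineK// ge0_fin_numE// ltW.
have rho0 z : 0 < ball_scale c r z `^ e by rewrite powR_gt0// ball_scale_gt0.
split.
  apply: (@le_trans _ _ (\int[leb n]_z `|(f z * v z) * phi z|%:E)%E).
    apply: ae_ge0_le_integral => //.
    - by move=> x _; rewrite lee_fin divr_ge0// ltW.
    - apply/measurable_EFinP; apply: measurable_funM => //.
      exact: measurableT_comp.
    - apply/measurable_EFinP; apply: measurableT_comp => //.
      exact: measurable_funM.
    - apply: filterS v_gt0 => z vz _.
      rewrite lee_fin /phi mulrA mulfK ?gt_eqF// normrM [X in _ <= _ * X]ger0_norm//.
      by rewrite invr_ge0 ltW.
  rewrite EFinM hK MK.
  exact: (integral_norm_mul_le (leb_setT_gt0 n0) p1 mfv mphi).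
have [H [mH H0 H1 hH]] := Lnorm_factorization (leb_setT_gt0 n0) p1 mfv fvoo.
have kr0 : 0 < kappa * r by rewrite mulr_gt0.
pose L := ((2 + kappa) * r) `^ e.
have k20 : 0 < 2 + kappa by rewrite addr_gt0.
have L0 : 0 < L by rewrite powR_gt0// mulr_gt0.
have vphi : {ae leb n, forall x, eball c (kappa * r) x -> (v x)^-1 <= L * phi x}.
  apply: filterS v_gt0 => z vz zB.
  rewrite /phi mulrCA ler_peMr ?invr_ge0 ?(ltW vz)// ler_pdivlMr// mul1r.
  apply: ge0_ler_powR; rewrite ?nnegrE ?(ltW e0) ?(ltW (ball_scale_gt0 _ _ _))//.
    by rewrite mulr_ge0 ?(ltW k20) ?(ltW r0).
  have zB' : eucl_dist c z < kappa * r by [].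
  by apply: (le_trans (ball_scale_le c z r0)); lra.
have [U [mU U0 U1 vU]] := HC0 c (kappa * r) L phi kr0 L0 mphi vphi M0 Moo.
exists H, U; split => //.
apply: filterS3 v_gt0 hH vU => z vz hz vz' zB; have {}vz' := vz' zB.
have -> : `|f z| = `|f z * v z| * (v z)^-1.
  by rewrite normrM (gtr0_norm vz) mulfK// gt_eqF.
apply: (le_trans (ler_pM _ _ hz vz')) => //; first by rewrite invr_ge0 ltW.
rewrite -/h -/M -/t -/y.
set V := fine (leb n (eball c (kappa * r))).
have V0 : 0 < V by exact: fine_leb_eball_gt0.
(* The volume is only used through its lower bound K r^n. *)
have VK : V `^ (- (t * y)) <= K `^ (- (t * y)) * r `^ (- (n%:R * t * y)).
  have -> : r `^ (- (n%:R * t * y)) = (r ^+ n) `^ (- (t * y)).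
    by rewrite -powR_mulrn ?(ltW r0)// -powRrM; congr (_ `^ _); ring.
  rewrite -powRM ?(ltW K0) ?exprn_ge0 ?(ltW r0)// -exprMn.
  rewrite !powRN lef_pV2 ?posrE ?powR_gt0//; last first.
    by rewrite exprn_gt0// !mulr_gt0// invr_gt0 ltr0n.
  apply: ge0_ler_powR; rewrite ?nnegrE ?mulr_ge0 ?(ltW V0)//.
    by rewrite exprn_ge0// !mulr_ge0 ?invr_ge0 ?ler0n ?(ltW k0) ?(ltW r0).
  rewrite -lee_fin leb_eball_fineK//; apply: le_trans (leb_eball_ge c kr0 n0).
  by rewrite lee_fin (_ : 2 * (kappa / n%:R) * r = 2 * (kappa * r / n%:R))//; ring.
have -> : C0 * (2 + kappa) `^ e * K `^ (- (t * y)) * (h * fine M) *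
    r `^ (e - n%:R * t * y) * (H z `^ fine p^-1 * U z `^ (t / m%:R)) =
  h * H z `^ fine p^-1 * (C0 * (L * fine M) *
    (K `^ (- (t * y)) * r `^ (- (n%:R * t * y))) * U z `^ (t / m%:R)).
  rewrite /L powRM ?(ltW k20) ?(ltW r0)// powRD ?(gt_eqF r0) ?implybT//; ring.
have h0 : 0 <= h by rewrite fine_ge0// Lnorm_ge0.
rewrite ler_wpM2l ?mulr_ge0 ?powR_ge0// ler_wpM2r ?powR_ge0// ler_wpM2l//.
by rewrite !mulr_ge0 ?(ltW C0p) ?(ltW L0)// fine_ge0// ltW.
Qed.

End ball_scale.

(** * A multilinear form with a kernel in each variable *)

Section tuple_almost_everywhere.
Context d (T : measurableType d) (R : realType).
Variable mu : {sigma_finite_measure set T -> \bar R}.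

(** A property that holds almost everywhere in each variable holds almost
    everywhere for the product measure, which vanishes on the boxes with a null
    side. *)
Lemma ae_tuple m (P : 'I_m -> T -> Prop) :
  (forall i, {ae mu, forall z, P i z}) ->
  {ae tuple_measure mu m, forall y, forall i, P i (tnth y i)}.
Proof.
move=> aeP.
have : {ae tuple_measure mu m, forall y, forall k : nat,
    forall i : 'I_m, i = k :> nat -> P i (tnth y i)}.
  apply: ae_foralln => k; have [km|mk] := ltnP k m; last first.
    by apply: aeW => y i ik; move: (ltn_ord i); rewrite ik ltnNge mk.
  have [N [mN N0 PN]] := aeP (Ordinal km).
  exists [set y | forall j, (if j == Ordinal km then N else setT) (tnth y j)].
  have mA j : measurable (if j == Ordinal km then N else setT) by case: ifP.
  split.
  - rewrite (_ : [set y | _] = \bigcap_(j in setT) ((fun y : m.-tuple T => tnth y j) @^-1`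
        (if j == Ordinal km then N else setT))).
      apply: fin_bigcap_measurable => // j _.
      rewrite -[X in measurable X]setTI.
      exact: (@measurable_tnth _ T m j measurableT _ (mA j)).
    by apply/seteqP; split => y /= h j; [move=> _; exact: h|exact: h].
  - rewrite [LHS](tuple_measure_box mu mA) (bigD1 (Ordinal km))//= eqxx.
    by rewrite [X in (X * _)%E](_ : _ = 0%E) ?mul0e.
  - move=> y /= nP j; case: ifPn => // /eqP ->.
    apply: PN => /= Py; apply: nP => i ik.
    by have -> : i = Ordinal km by apply/val_inj.
by apply: filterS => y Hy i; exact: (Hy i i).
Qed.

End tuple_almost_everywhere.

Section multilinear_form.
Context {R : realType}.

(** The weighted arithmetic-geometric inequality, with the convention
    [0 `^ 0 = 1] at the endpoints. *)
Lemma young_powR (a b t : R) : 0 <= a -> 0 <= b -> 0 <= t <= 1 ->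
  a `^ t * b `^ (1 - t) <= t * a + (1 - t) * b.
Proof.
move=> a0 b0 /andP[t0 t1].
have [->|tn0] := eqVneq t 0.
  by rewrite powRr0 subr0 powRr1// mul0r add0r.
have [->|tn1] := eqVneq t 1.
  by rewrite subrr powRr0 powRr1// mul0r addr0 mulr1 mul1r.
have tp : 0 < t by rewrite lt0r tn0.
have t1p : 0 < 1 - t by rewrite subr_gt0 lt_neqAle tn1.
have := @conjugate_powR R (a `^ t) (b `^ (1 - t)) t^-1 (1 - t)^-1
  (powR_ge0 _ _) (powR_ge0 _ _).
rewrite !invr_gt0 !invrK => /(_ tp t1p); rewrite addrC subrK => /(_ erefl).
by rewrite -!powRrM !divff ?gt_eqF// !powRr1// (mulrC a) (mulrC b).
Qed.

Lemma powR_prod (I : finType) (F : I -> R) (s : R) : (forall i, 0 <= F i) ->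
  (\prod_i F i) `^ s = \prod_i F i `^ s.
Proof.
move=> F0; apply: (@proj2 (0 <= \prod_i F i)).
elim/big_ind2: _ => [|a b a' b' [a0 ea] [b0 eb]|i _]; first by rewrite powR1.
  by rewrite mulr_ge0// powRM// ea eb.
by [].
Qed.

(** The exponents of [k], [H] and [U] make the product a geometric mean, over
    the choice of a distinguished index [j], of products that the weighted
    arithmetic-geometric inequality splits. *)
Lemma prod_powR_le_sum m (k H U t : 'I_m -> R) : (0 < m)%N ->
  (forall i, 0 <= k i) -> (forall i, 0 <= H i) -> (forall i, 0 <= U i) ->
  (forall i, 0 <= t i <= 1) ->
  \prod_i (k i `^ (1 - (1 - m%:R^-1) * t i) *
           (H i `^ t i * U i `^ ((1 - t i) / m%:R))) <=
  \sum_j \prod_i (if i == j then k i * (t i * H i + (1 - t i) * U i)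
                  else t i * H i + (1 - t i) * k i).
Proof.
case: m k H U t => [|m] k H U t// _ k0 H0 U0 t01.
set u : R := m.+1%:R^-1.
have M0 : 0 < m.+1%:R :> R by rewrite ltr0n.
have u0 : 0 < u by rewrite invr_gt0.
have root (a : R) : 0 <= a -> (a `^ u) ^+ m.+1 = a.
  by move=> a0; rewrite -powR_mulrn ?powR_ge0// -powRrM mulVf ?gt_eqF// powRr1.
(* psi i j is the i-th factor of the product whose distinguished index is j. *)
pose psi (i j : 'I_m.+1) := if i == j then k i * (H i `^ t i * U i `^ (1 - t i))
  else H i `^ t i * k i `^ (1 - t i).
pose Phi (i j : 'I_m.+1) := if i == j then k i * (t i * H i + (1 - t i) * U i)
  else t i * H i + (1 - t i) * k i.
have psi0 i j : 0 <= psi i j.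
  by rewrite /psi; case: ifP => _; rewrite !mulr_ge0 ?powR_ge0.
have psiPhi i j : psi i j <= Phi i j.
  rewrite /psi /Phi; case: ifP => _; last exact: young_powR.
  by rewrite ler_wpM2l// young_powR.
have Phi0 i j : 0 <= Phi i j by exact: le_trans (psiPhi i j).
set X := \sum_j _; have X0 : 0 <= X.
  by apply: sumr_ge0 => j _; apply: prodr_ge0 => i _; exact: (Phi0 i j).
have factor i : k i `^ (1 - (1 - u) * t i) * (H i `^ t i * U i `^ ((1 - t i) / m.+1%:R)) =
    \prod_j psi i j `^ u.
  rewrite (bigD1 i)//= {1}/psi eqxx.
  rewrite (eq_bigr (fun _ => (H i `^ t i * k i `^ (1 - t i)) `^ u)); last first.
    by move=> j ji; rewrite /psi eq_sym (negbTE ji).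
  rewrite prodr_const cardC1 card_ord /=.
  rewrite !powRM ?powR_ge0 ?mulr_ge0 ?powR_ge0// exprMn.
  rewrite -/u [U i `^ ((1 - t i) * u)]powRrM.
  have -> : k i `^ (1 - (1 - u) * t i) = k i `^ u * ((k i `^ (1 - t i)) `^ u) ^+ m.
    rewrite -powR_mulrn ?powR_ge0// -!powRrM -powRD; last first.
      (* The exponents of k i have a positive sum, which excludes 0 `^ 0. *)
      apply/implyP => /eqP h; exfalso.
      have /andP[t0 t1] := t01 i.
      have : 0 < u + (1 - t i) * (u * m%:R).
        by rewrite ltr_pwDl// !mulr_ge0 ?subr_ge0// ltW.
      by rewrite h ltxx.
    congr (_ `^ _); have -> : m%:R = u^-1 - 1 :> R.
      by rewrite /u invrK -natr1 addrK.
    by field; rewrite gt_eqF.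
  have -> : H i `^ t i * (U i `^ (1 - t i)) `^ u = (H i `^ t i) `^ u *
      ((H i `^ t i) `^ u) ^+ m * (U i `^ (1 - t i)) `^ u.
    by rewrite -exprS root// powR_ge0.
  have shuffle (a1 a2 a3 a4 a5 : R) :
      a1 * a2 * (a3 * a4 * a5) = a1 * (a3 * a5) * (a4 * a2) by ring.
  exact: shuffle.
rewrite (eq_bigr _ (fun i _ => factor i)) exchange_big/=.
apply: (@le_trans _ _ (\prod_(j < m.+1) X `^ u)); last first.
  by rewrite prodr_const card_ord root.
apply: ler_prod => j _; rewrite prodr_ge0/=; last by move=> i _; exact: powR_ge0.
rewrite -powR_prod//.
apply: ge0_ler_powR; rewrite ?nnegrE ?(ltW u0)//; first by apply: prodr_ge0.
apply: (@le_trans _ _ (\prod_i Phi i j)).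
  by apply: ler_prod => i _; rewrite psi0 psiPhi.
rewrite /X [leRHS](bigD1 j)//= lerDl; apply: sumr_ge0 => l _.
by apply: prodr_ge0 => i _; exact: (Phi0 i l).
Qed.

End multilinear_form.

Lemma lee_prode (R : realDomainType) (I : finType) (Q : pred I) (a b : I -> \bar R) :
  (forall i, Q i -> 0 <= a i <= b i)%E ->
  (\prod_(i | Q i) a i <= \prod_(i | Q i) b i)%E.
Proof.
move=> ab; apply: (@proj2 (0 <= \prod_(i | Q i) a i)%E).
elim/big_ind2: _ => [|x y x' y' [x0 xy] [x'0 xy']|i /ab/andP[]]//.
by split; [exact: mule_ge0|exact: lee_pmul].
Qed.

Section multilinear_form_estimate.
Context d (T : measurableType d) (R : realType).
Variable mu : {sigma_finite_measure set T -> \bar R}.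
Variables (m : nat) (B D : set T) (k : T -> T -> R) (K : R).
Variables (H U : 'I_m -> T -> R) (t : 'I_m -> R).
Hypotheses (m0 : (0 < m)%N) (mB : measurable B) (mD : measurable D).
Hypothesis mk : measurable_fun setT (fun z : T * T => k z.1 z.2).
Hypothesis k0 : forall x y, 0 <= k x y.
Hypothesis K1 : 1 <= K.
Hypothesis kD : forall x, B x -> (\int[mu]_(y in D) (k x y)%:E <= K%:E)%E.
Hypothesis kB : forall y, D y -> (\int[mu]_(x in B) (k x y)%:E <= K%:E)%E.
Hypotheses (mH : forall i, measurable_fun setT (H i))
  (mU : forall i, measurable_fun setT (U i)).
Hypotheses (H0 : forall i x, 0 <= H i x) (U0 : forall i x, 0 <= U i x).
Hypotheses (H1 : forall i, (\int[mu]_x (H i x)%:E <= 1)%E)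
  (U1 : forall i, (\int[mu]_x (U i x)%:E <= 1)%E).
Hypothesis t01 : forall i, 0 <= t i <= 1.

(* W i and P i j are the functions into which the weighted
   arithmetic-geometric inequality splits the integrand. *)
Let W i z : R := t i * H i z + (1 - t i) * U i z.

Let P i j x z : R := \1_D z * (if i == j then k x z * W i z
  else t i * H i z + (1 - t i) * k x z).

Let t0 i : 0 <= t i. Proof. by have /andP[] := t01 i. Qed.
Let t1 i : 0 <= 1 - t i. Proof. by rewrite subr_ge0; have /andP[] := t01 i. Qed.
Let W0 i z : 0 <= W i z. Proof. by rewrite addr_ge0// mulr_ge0. Qed.
Let P0 i j x z : 0 <= P i j x z.
Proof. by rewrite mulr_ge0//; case: ifP => _; rewrite ?addr_ge0 ?mulr_ge0. Qed.

Let mW i : measurable_fun setT (W i).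
Proof. by apply: measurable_funD; apply: measurable_funM. Qed.

Let mP i j : measurable_fun setT (fun z : T * T => P i j z.1 z.2).
Proof.
apply: measurable_funM.
  exact: (measurableT_comp (measurable_indic mD) measurable_snd).
case: eqP => _.
  by apply: measurable_funM => //; exact: (measurableT_comp (mW i) measurable_snd).
apply: measurable_funD; apply: measurable_funM => //.
exact: (measurableT_comp (mH i) measurable_snd).
Qed.

Let mPx i j x : measurable_fun setT (P i j x).
Proof. exact: (measurableT_comp (mP i j) (pair1_measurable x)). Qed.

Let mkx x : measurable_fun setT (k x).
Proof. exact: (measurableT_comp mk (pair1_measurable x)). Qed.

Let mky y : measurable_fun setT (k ^~ y).
Proof. exact: (measurableT_comp mk (pair2_measurable y)). Qed.

Let convex_comb_le (F G : T -> R) (L : R) i :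
  measurable_fun setT F -> measurable_fun setT G ->
  (forall z, 0 <= F z) -> (forall z, 0 <= G z) -> 0 <= L ->
  (\int[mu]_z (F z)%:E <= L%:E)%E -> (\int[mu]_z (G z)%:E <= L%:E)%E ->
  (\int[mu]_z (t i * F z + (1 - t i) * G z)%:E <= L%:E)%E.
Proof.
move=> mF mG F0 G0 L0 FL GL.
under eq_integral do rewrite EFinD 2!EFinM.
have mE (g : T -> R) : measurable_fun setT g -> measurable_fun setT (EFin \o g).
  by move=> mg; exact/measurable_EFinP.
rewrite ge0_integralD//=; last 4 first.
- by move=> z _; rewrite -EFinM lee_fin mulr_ge0.
- by apply: emeasurable_funM => //; exact: mE.
- by move=> z _; rewrite -EFinM lee_fin mulr_ge0.
- by apply: emeasurable_funM => //; exact: mE.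
rewrite !ge0_integralZl_EFin//; try by [exact: mE | move=> z _; rewrite lee_fin].
apply: (@le_trans _ _ ((t i)%:E * L%:E + (1 - t i)%:E * L%:E)%E).
  by apply: leeD; apply: lee_wpmul2l; rewrite ?lee_fin.
by rewrite -!EFinM -EFinD lee_fin -mulrDl addrC subrK mul1r.
Qed.

Let W1 i : (\int[mu]_z (W i z)%:E <= 1%:E)%E.
Proof. by apply: convex_comb_le. Qed.

Let indic_integral (F : T -> R) : measurable_fun setT F ->
  (\int[mu]_z (\1_D z * F z)%:E = \int[mu]_(z in D) (F z)%:E)%E.
Proof.
move=> mF; rewrite [RHS]integral_mkcond; apply: eq_integral => z _.
by rewrite patchE indicE; case: ifPn => zD; rewrite ?mul1r ?mul0r.
Qed.

Let P_offdiag i j x : B x -> i != j -> (\int[mu]_z (P i j x z)%:E <= K%:E)%E.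
Proof.
move=> Bx ij; have K0 : 0 <= K by exact: le_trans K1.
apply: (@le_trans _ _ (\int[mu]_z (t i * H i z + (1 - t i) * (\1_D z * k x z))%:E)%E).
  apply: ge0_le_integral => //.
  - by move=> z _; rewrite lee_fin.
  - exact/measurable_EFinP.
  - apply/measurable_EFinP; apply: measurable_funD; apply: measurable_funM => //.
    exact: measurable_funM.
  - move=> z _; rewrite lee_fin /P (negbTE ij) mulrDr [X in _ + X <= _]mulrCA lerD2r.
    rewrite ler_piMl ?mulr_ge0// indicE; by case: (_ \in _).
apply: convex_comb_le => //.
- exact: measurable_funM.
- by move=> z; rewrite mulr_ge0.
- by apply: le_trans (H1 i) _; rewrite lee_fin.
- by rewrite indic_integral//; exact: kD.
Qed.

Let P_diag j : (\int[mu]_(x in B) \int[mu]_z (P j j x z)%:E <= K%:E)%E.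
Proof.
have K0 : 0 <= K by exact: le_trans K1.
pose Q (z : T * T) := (\1_B z.1 * P j j z.1 z.2)%:E.
have mQ : measurable_fun setT Q.
  apply/measurable_EFinP; apply: measurable_funM => //.
  exact: (measurableT_comp (measurable_indic mB) measurable_fst).
have Q0 z : (0 <= Q z)%E by rewrite lee_fin mulr_ge0.
rewrite (_ : (\int[mu]_(x in B) _ = \int[mu]_x \int[mu]_z Q (x, z))%E); last first.
  rewrite [LHS]integral_mkcond; apply: eq_integral => x _.
  rewrite patchE /Q /= indicE; case: ifPn => xB.
    by under [RHS]eq_integral do rewrite mul1r.
  by rewrite integral0_eq// => z _; rewrite mul0r.
rewrite (fubini_tonelli Q)//.
apply: (@le_trans _ _ (\int[mu]_y (K%:E * (W j y)%:E))%E); last first.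
  rewrite ge0_integralZl_EFin//; last first.
  - exact/measurable_EFinP.
  - by move=> z _; rewrite lee_fin.
  by rewrite -[leRHS]mule1; apply: lee_wpmul2l.
apply: ge0_le_integral => //.
- by move=> y _; exact: integral_ge0.
- exact: measurable_fun_fubini_tonelli_G.
- by apply: emeasurable_funM => //; exact/measurable_EFinP.
move=> y _; have [yD|yD] := pselect (D y); last first.
  rewrite integral0_eq ?mule_ge0 ?lee_fin// => x _.
  by rewrite /Q/= /P [\1_D y]indicE memNset// mul0r mulr0.
rewrite (_ : (\int[mu]_x _ = \int[mu]_x ((W j y)%:E * (\1_B x * k x y)%:E))%E); last first.
  apply: eq_integral => x _; rewrite /Q/= /P eqxx [\1_D y]indicE mem_set// mul1r -EFinM.
  by congr (_%:E); ring.
rewrite ge0_integralZl_EFin//; last first.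
- by apply/measurable_EFinP; apply: measurable_funM.
- by move=> x _; rewrite lee_fin mulr_ge0.
rewrite muleC; apply: lee_wpmul2r; first by rewrite lee_fin.
apply: le_trans (kB yD); rewrite [leRHS]integral_mkcond le_eqVlt; apply/orP; left.
apply/eqP; apply: eq_integral => x _.
by rewrite patchE indicE; case: ifPn => xB; rewrite ?mul1r ?mul0r.
Qed.

Let integrand i x z : R := \1_D z * (k x z `^ (1 - (1 - m%:R^-1) * t i) *
  (H i z `^ t i * U i z `^ ((1 - t i) / m%:R))).

Let integrand_le x (y : m.-tuple T) :
  \prod_i integrand i x (tnth y i) <= \sum_j \prod_i P i j x (tnth y i).
Proof.
rewrite big_split/=.
rewrite [leRHS](eq_bigr (fun j => (\prod_i (\1_D (tnth y i) : R)) *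
    \prod_i (if i == j then k x (tnth y i) * W i (tnth y i)
      else t i * H i (tnth y i) + (1 - t i) * k x (tnth y i)))); last first.
  by move=> j _; rewrite -big_split.
rewrite -mulr_sumr; apply: ler_wpM2l; first by apply: prodr_ge0 => i _.
exact: (@prod_powR_le_sum R m (fun i => k x (tnth y i)) (fun i => H i (tnth y i))
  (fun i => U i (tnth y i)) t m0).
Qed.

(** For each distinguished index [j], the variables [y_i] with [i != j] are
    integrated first, then [x], whose only remaining factor is [k x y_j], and
    [y_j] last. *)
Lemma multilinear_form_le :
  (\int[mu]_(x in B) \int[tuple_measure mu m]_y
    (\prod_i (\1_D (tnth y i) *
      (k x (tnth y i) `^ (1 - (1 - m%:R^-1) * t i) *
       (H i (tnth y i) `^ t i * U i (tnth y i) `^ ((1 - t i) / m%:R)))))%:E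
   <= (m%:R * K ^+ m)%:E)%E.
Proof.
have K0 : 0 <= K by exact: le_trans K1.
have I0 i x z : 0 <= integrand i x z.
  by rewrite !mulr_ge0 ?powR_ge0.
have mI i : measurable_fun setT (fun z : T * T => integrand i z.1 z.2).
  apply: measurable_funM.
    exact: (measurableT_comp (measurable_indic mD) measurable_snd).
  apply: measurable_funM; first exact: (measurableT_comp (measurable_powR _) mk).
  apply: measurable_funM; apply: (measurableT_comp (measurable_powR _)).
    exact: (measurableT_comp (mH i) measurable_snd).
  exact: (measurableT_comp (mU i) measurable_snd).
have mt i : measurable_fun setT (fun z : T * m.-tuple T => (z.1, tnth z.2 i)).
  apply/measurable_fun_pair => //=.
  exact: (measurableT_comp (measurable_tnth i) measurable_snd).
have mprod (F : 'I_m -> T -> T -> R) :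
    (forall i, measurable_fun setT (fun z : T * T => F i z.1 z.2)) ->
    measurable_fun setT (fun z : T * m.-tuple T => (\prod_i F i z.1 (tnth z.2 i))%:E).
  move=> mF; apply/measurable_EFinP.
  apply: (@measurable_prod _ _ _ _ _ _ (fun i (z : T * m.-tuple T) => F i z.1 (tnth z.2 i))) => i _.
  exact: (measurableT_comp (mF i) (mt i)).
have mprodx (F : 'I_m -> T -> T -> R) x :
    (forall i, measurable_fun setT (fun z : T * T => F i z.1 z.2)) ->
    measurable_fun setT (fun y : m.-tuple T => (\prod_i F i x (tnth y i))%:E).
  move=> mF; exact: (measurableT_comp (mprod F mF) (pair1_measurable x)).
have mPF j : measurable_fun setT (fun x => (\int[mu]_z (P j j x z)%:E)%E).
  apply: (@measurable_fun_fubini_tonelli_F _ _ _ _ _ mu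
    (fun z : T * T => (P j j z.1 z.2)%:E)); first exact/measurable_EFinP.
  by move=> z; rewrite lee_fin.
have PP0 j x : (0 <= \int[mu]_z (P j j x z)%:E)%E.
  by apply: integral_ge0 => z _; rewrite lee_fin.
apply: (@le_trans _ _ (\int[mu]_(x in B) \sum_j ((K ^+ m.-1)%:E *
    \int[mu]_z (P j j x z)%:E))%E); last first.
  rewrite ge0_integral_sum//; last 2 first.
  - move=> j; apply: emeasurable_funM => //; exact: measurable_funTS.
  - by move=> j x _; rewrite mule_ge0// lee_fin exprn_ge0.
  have -> : (m%:R * K ^+ m)%:E = (\sum_(j < m) (K ^+ m)%:E)%E.
    by rewrite sumEFin sumr_const card_ord mulr_natl.
  apply: lee_sum => j _; rewrite ge0_integralZl_EFin ?exprn_ge0//; last first.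
    exact: measurable_funTS.
  rewrite -{2}(prednK m0) exprSr EFinM.
  by apply: lee_wpmul2l; [rewrite lee_fin exprn_ge0|exact: P_diag].
apply: ge0_le_integral => //.
- move=> x _; apply: integral_ge0 => y _; rewrite lee_fin.
  by apply: prodr_ge0 => i _; exact: I0.
- apply: measurable_funTS.
  apply: (@measurable_fun_fubini_tonelli_F _ _ _ _ _ (tuple_measure mu m)
    (fun z : T * m.-tuple T => (\prod_i integrand i z.1 (tnth z.2 i))%:E)).
    exact: (mprod _ mI).
  by move=> z; rewrite lee_fin; apply: prodr_ge0 => i _; exact: I0.
- apply: measurable_funTS; apply: emeasurable_sum => j.
  exact: emeasurable_funM.
move=> x Bx.
apply: (@le_trans _ _ (\int[tuple_measure mu m]_y
    \sum_j (\prod_i P i j x (tnth y i))%:E)%E).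
  apply: ge0_le_integral => //.
  - by move=> y _; rewrite lee_fin; apply: prodr_ge0 => i _; exact: I0.
  - exact: (mprodx _ x mI).
  - by apply: emeasurable_sum => j; exact: (mprodx (fun i => P i j) x (fun i => mP i j)).
  - by move=> y _; rewrite sumEFin lee_fin; exact: integrand_le.
rewrite ge0_integral_sum//; last 2 first.
- by move=> j; exact: (mprodx (fun i => P i j) x (fun i => mP i j)).
- by move=> j y _; rewrite lee_fin; apply: prodr_ge0.
apply: lee_sum => j _.
under eq_integral do rewrite -prodEFin.
rewrite (integral_tuple_prod mu (F := fun i z => (P i j x z)%:E)); last 2 first.
- by move=> i; exact/measurable_EFinP.
- by move=> i z; rewrite lee_fin.
rewrite (bigD1 j)//= muleC; apply: lee_wpmul2r; first exact: PP0.
have -> : (K ^+ m.-1)%:E = (\prod_(i < m | i != j) K%:E)%E.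
  rewrite prodEFin prodr_const; congr (_ ^+ _)%:E.
  by rewrite cardC1 card_ord.
apply: lee_prode => i ij; apply/andP; split.
  by apply: integral_ge0 => z _; rewrite lee_fin.
exact: P_offdiag.
Qed.

End multilinear_form_estimate.

(** * Pointwise bounds on the commutator integrand *)

Section pointwise_bounds.
Context {R : realType} {n m : nat}.
Implicit Types (x z c : euclid R n) (y : m.-tuple (euclid R n)).

Lemma sum_eucl_dist_ge0 x y : 0 <= sum_eucl_dist x y.
Proof. by apply: sumr_ge0 => i _; exact: eucl_dist_ge0. Qed.

Lemma eucl_dist_le_sum_eucl_dist x y i :
  eucl_dist x (tnth y i) <= sum_eucl_dist x y.
Proof.
rewrite /sum_eucl_dist (bigD1 i)//= lerDl.
by apply: sumr_ge0 => j _; exact: eucl_dist_ge0.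
Qed.

Lemma sum_eucl_dist_le x z y :
  sum_eucl_dist x y <= sum_eucl_dist z y + m%:R * eucl_dist x z.
Proof.
rewrite /sum_eucl_dist mulr_natl -[X in _ *+ X]card_ord -sumr_const -big_split/=.
apply: ler_sum => i _; rewrite addrC; exact: eucl_dist_triangle.
Qed.

Lemma prodr_powR_sum (I : finType) (a : I -> R) (s : R) : 0 < s ->
  \prod_i s `^ a i = s `^ (\sum_i a i).
Proof.
move=> s0; elim/big_rec2 : _ => [|i y1 y2 _ ->]; first by rewrite powRr0.
by rewrite powRD// (gt_eqF s0) implybT.
Qed.

Lemma ler_powRN (a s u : R) : 0 <= a -> 0 < s -> s <= u -> u `^ (- a) <= s `^ (- a).
Proof.
move=> a0 s0 su; have u0 : 0 < u by exact: lt_le_trans su.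
rewrite !powRN lef_pV2 ?posrE ?powR_gt0//.
by apply: ge0_ler_powR; rewrite ?nnegrE ?(ltW s0) ?(ltW u0).
Qed.

Let prodr_diff_leS k (a a' : 'I_k.+1 -> R) (Q D : R) :
  (forall i, `|a i| <= Q) -> (forall i, `|a' i| <= Q) ->
  (forall i, `|a i - a' i| <= D) ->
  `|\prod_i a i - \prod_i a' i| <= k.+1%:R * D * Q ^+ k.
Proof.
elim: k a a' => [|k IH] a a' aQ a'Q aD.
  by rewrite !big_ord_recl !big_ord0 !mulr1 mul1r.
have Q0 : 0 <= Q by exact: le_trans (aQ ord0).
have D0 : 0 <= D by exact: le_trans (aD ord0).
rewrite big_ord_recl [X in _ - X]big_ord_recl.
set A := \prod_(i < k.+1) _; set A' := \prod_(i < k.+1) _.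
have -> : a ord0 * A - a' ord0 * A' = (a ord0 - a' ord0) * A + a' ord0 * (A - A') by ring.
apply: (le_trans (ler_normD _ _)); rewrite !normrM.
have -> : k.+2%:R * D * Q ^+ k.+1 = D * Q ^+ k.+1 + Q * (k.+1%:R * D * Q ^+ k).
  by rewrite exprS -natr1; ring.
apply: lerD; apply: ler_pM => //.
- rewrite normr_prod -[k.+1 in leRHS]card_ord -prodr_const.
  by apply: ler_prod => i _; rewrite normr_ge0 aQ.
- exact: IH.
Qed.

Lemma prodr_diff_le k (a a' : 'I_k -> R) (Q D : R) : (0 < k)%N ->
  (forall i, `|a i| <= Q) -> (forall i, `|a' i| <= Q) ->
  (forall i, `|a i - a' i| <= D) ->
  `|\prod_i a i - \prod_i a' i| <= k%:R * D * Q ^+ k.-1.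
Proof. by case: k a a' => [|k] a a'// _; exact: prodr_diff_leS. Qed.

Lemma Lipschitz_family (delta : R) (b : 'I_m -> euclid R n -> R) :
  (forall i, Lipschitz_space delta (b i)) ->
  exists C : R, 0 < C /\ forall i x z, `|b i x - b i z| <= C * eucl_dist x z `^ delta.
Proof.
move=> hb; pose c i := sval (cid (hb i)).
have c0 : 0 <= \sum_i `|c i| by exact: sumr_ge0.
exists (1 + \sum_i `|c i|); split; first by rewrite ltr_pwDl.
move=> i x z; apply: (le_trans (svalP (cid (hb i)) x z)).
rewrite ler_wpM2r ?powR_ge0// -/(c i) (bigD1 i)//= addrCA.
apply: (le_trans (ler_norm _)); rewrite lerDl addr_ge0//.
exact: sumr_ge0.
Qed.

Lemma size_condition_pos (alpha : R) K : size_condition alpha K ->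
  exists C : R, 0 < C /\ forall x y, 0 < sum_eucl_dist x y ->
    `|K x y| <= C * sum_eucl_dist x y `^ (- ((m * n)%:R - alpha)).
Proof.
move=> [C HC]; exists (Num.max C 1); split; first by rewrite lt_max ltr01 orbT.
move=> x y S0; apply: (le_trans (HC x y S0)).
by rewrite ler_wpM2r ?powR_ge0// le_max lexx.
Qed.

(** If all the distances vanish then so does the integrand, which is consistent
    with [0 `^ a = 0] on the right; this needs [0 < m]. *)
Lemma commutator_integrand_le (Cb CK alpha delta : R) K (b f : 'I_m -> euclid R n -> R) :
  (0 < m)%N -> 0 <= Cb -> 0 <= CK -> 0 < delta ->
  (forall i x z, `|b i x - b i z| <= Cb * eucl_dist x z `^ delta) ->
  (forall x y, 0 < sum_eucl_dist x y ->
    `|K x y| <= CK * sum_eucl_dist x y `^ (- ((m * n)%:R - alpha))) ->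
  forall x y, `|commutator_integrand K b f x y| <= CK * Cb ^+ m *
    sum_eucl_dist x y `^ (- ((m * n)%:R - alpha - m%:R * delta)) *
    \prod_i `|f i (tnth y i)|.
Proof.
move=> m0 Cb0 CK0 d0 Hb HK x y.
rewrite /commutator_integrand big_split/= !normrM -!normr_prod !mulrA.
apply: ler_wpM2r => //; rewrite normr_prod.
have S0 := sum_eucl_dist_ge0 x y; set S := sum_eucl_dist x y in S0 *.
have Hprod : \prod_i `|b i x - b i (tnth y i)| <= Cb ^+ m * S `^ (m%:R * delta).
  rewrite (mulrC m%:R) powRrM powR_mulrn ?powR_ge0// -exprMn.
  rewrite -[m in leRHS]card_ord -prodr_const.
  apply: ler_prod => i _; rewrite normr_ge0/=; apply: (le_trans (Hb _ _ _)).
  apply: ler_wpM2l => //; apply: ge0_ler_powR; rewrite ?nnegrE ?(ltW d0)//.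
  - exact: eucl_dist_ge0.
  - exact: eucl_dist_le_sum_eucl_dist.
have [Se0|Sn0] := eqVneq S 0.
  rewrite [X in _ * X <= _](_ : _ = 0) ?mulr0 ?mulr_ge0 ?powR_ge0 ?exprn_ge0//.
  apply/eqP; rewrite eq_le prodr_ge0 ?andbT; last by move=> i _; exact: normr_ge0.
  by apply: (le_trans Hprod); rewrite Se0 powR0 ?mulr0// mulf_neq0 ?gt_eqF ?ltr0n.
have Sp : 0 < S by rewrite lt0r Sn0.
have -> : S `^ (- ((m * n)%:R - alpha - m%:R * delta)) =
    S `^ (- ((m * n)%:R - alpha)) * S `^ (m%:R * delta).
  by rewrite -powRD ?(gt_eqF Sp) ?implybT//; congr (_ `^ _); ring.
apply: (le_trans (ler_pM _ _ (HK x y Sp) Hprod)) => //; first by rewrite prodr_ge0.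
rewrite -/S le_eqVlt; apply/orP; left; apply/eqP.
move: (S `^ _) (S `^ _) (Cb ^+ m) => u1 u2 u3; ring.
Qed.

(** Near the diagonal the size of the kernel and the smoothness of the symbols
    leave a kernel that is homogeneous of degree [- lam]. It is bounded by a
    product of powers of normalized Riesz kernels, one in each variable. *)
Lemma near_kernel_le (lam eps kappa : R) (om : 'I_m -> R) : (0 < m)%N ->
  1 <= kappa -> 0 < eps < n%:R -> (forall i, 0 <= om i) ->
  lam <= (n%:R - eps) * \sum_i om i ->
  exists C : R, 0 < C /\ forall c (r : R) x y, 0 < r ->
    eball c r x -> (forall i, eball c (kappa * r) (tnth y i)) ->
    (forall i, 0 < eucl_dist x (tnth y i)) ->
    sum_eucl_dist x y `^ (- lam) <= C * r `^ (n%:R * (\sum_i om i) - lam) *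
      \prod_i (r `^ (- eps) * eucl_dist x (tnth y i) `^ (- (n%:R - eps))) `^ om i.
Proof.
move=> m0 k1 /andP[e0 en] om0; set Om := \sum_i om i => lamle.
have k0 : 0 < kappa by exact: lt_le_trans k1.
have mk0 : 0 < m%:R * (1 + kappa) by rewrite mulr_gt0 ?ltr0n// addr_gt0.
(* The excess a of homogeneity is absorbed by the bound on S below. *)
pose a := (n%:R - eps) * Om - lam; have a0 : 0 <= a by rewrite subr_ge0.
exists ((m%:R * (1 + kappa)) `^ a); split; first exact: powR_gt0.
move=> c r x y r0 xB yB d0.
set S := sum_eucl_dist x y.
have dS i : eucl_dist x (tnth y i) <= S by exact: eucl_dist_le_sum_eucl_dist.
have S0 : 0 < S by apply: lt_le_trans (dS (Ordinal m0)); exact: d0.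
have Sle : S <= m%:R * (1 + kappa) * r.
  rewrite /S /sum_eucl_dist -mulrA mulr_natl -[m in leRHS]card_ord -sumr_const.
  apply: ler_sum => i _; apply: (le_trans (eucl_dist_triangle c _ _)).
  by rewrite eucl_distC mulrDl mul1r; apply: lerD; apply: ltW; [exact: xB|exact: yB].
have e1 : S `^ (- lam) = S `^ a * \prod_i S `^ (- (n%:R - eps) * om i).
  rewrite prodr_powR_sum// -mulr_sumr -/Om -powRD ?(gt_eqF S0) ?implybT//.
  by congr (_ `^ _); rewrite /a; ring.
have e2 : r `^ (n%:R * Om - lam) = r `^ a * \prod_i r `^ (eps * om i).
  rewrite prodr_powR_sum// -mulr_sumr -/Om -powRD ?(gt_eqF r0) ?implybT//.
  by congr (_ `^ _); rewrite /a; ring.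
rewrite e1 e2 mulrA -powRM ?(ltW mk0) ?(ltW r0)// -mulrA -big_split/=.
apply: ler_pM; rewrite ?powR_ge0//; first by apply: prodr_ge0 => i _; exact: powR_ge0.
  by apply: ge0_ler_powR; rewrite ?nnegrE ?(ltW S0)// mulr_ge0 ?(ltW mk0) ?(ltW r0).
apply: ler_prod => i _; rewrite powR_ge0/=.
have -> : r `^ (eps * om i) *
    (r `^ (- eps) * eucl_dist x (tnth y i) `^ (- (n%:R - eps))) `^ om i =
    (eucl_dist x (tnth y i) `^ (- (n%:R - eps))) `^ om i.
  rewrite powRM ?powR_ge0// mulrA -powRrM -powRD ?(gt_eqF r0) ?implybT//.
  by rewrite mulNr addrN powRr0 mul1r.
rewrite [leLHS]powRrM.
apply: ge0_ler_powR; rewrite ?nnegrE ?powR_ge0//.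
by apply: ler_powRN => //; rewrite subr_ge0 ltW.
Qed.

End pointwise_bounds.

Section far_difference.
Context {R : realType} {n m : nat}.
Implicit Types (x z c : euclid R n) (y : m.-tuple (euclid R n)).

(** Away from the ball the difference of the integrands at two points of the
    ball gains the factor [(r / S) ^ delta], from the smoothness of the kernel
    and from that of the symbols. *)
Lemma far_difference_le (alpha gamma delta Cb CK Cs cs : R)
    (K : euclid R n -> m.-tuple (euclid R n) -> R)
    (b : 'I_m -> euclid R n -> R) (e_ : 'I_m -> R) :
  (0 < n)%N -> (0 < m)%N -> 0 < delta < gamma -> 0 < Cb -> 0 < CK -> 0 < Cs -> 0 < cs ->
  0 <= (m * n)%:R - alpha ->
  (forall i x z, `|b i x - b i z| <= Cb * eucl_dist x z `^ delta) ->
  (forall x y, 0 < sum_eucl_dist x y ->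
    `|K x y| <= CK * sum_eucl_dist x y `^ (- ((m * n)%:R - alpha))) ->
  (forall x x' y, cs * eucl_dist x x' < sum_eucl_dist x y ->
    `|K x y - K x' y| <= Cs * (eucl_dist x x' `^ gamma /
      sum_eucl_dist x y `^ ((m * n)%:R - alpha + gamma))) ->
  (forall i, 0 <= e_ i) ->
  \sum_i e_ i = (m * n)%:R - alpha - m%:R * delta + delta ->
  exists C : R, 0 < C /\ forall c (r : R) (f : 'I_m -> euclid R n -> R) x z y,
    0 < r -> eball c r x -> eball c r z ->
    ~ (forall i, eball c ((2 + 2 * cs) * r) (tnth y i)) ->
    `|commutator_integrand K b f x y - commutator_integrand K b f z y| <=
    C * r `^ delta *
      \prod_i (`|f i (tnth y i)| / ball_scale c r (tnth y i) `^ e_ i).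
Proof.
move=> n0 m0 /andP[d0 dg] Cb0 CK0 Cs0 cs0 mna Hb HK Hs e0 esum.
pose q : R := 1 + 2 * m%:R; have q1 : 1 <= q by rewrite lerDl mulr_ge0.
have q0 : 0 < q by exact: lt_le_trans q1.
pose a : R := (m * n)%:R - alpha; pose E := \sum_i e_ i.
pose C1 := Cs * 2 `^ gamma * Cb ^+ m.
pose C2 := CK * q `^ a * (m%:R * (Cb * 2 `^ delta) * (Cb * q `^ delta) ^+ m.-1).
have C10 : 0 < C1 by rewrite !mulr_gt0 ?powR_gt0 ?exprn_gt0.
have C20 : 0 < C2 by rewrite !mulr_gt0 ?powR_gt0 ?exprn_gt0 ?mulr_gt0 ?powR_gt0 ?ltr0n.
exists ((C1 + C2) * 4 `^ E); split; first by rewrite mulr_gt0 ?powR_gt0 ?addr_gt0.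
move=> c r f x z y r0 xB zB /existsNP[i0 yi0].
have {}yi0 : (2 + 2 * cs) * r <= eucl_dist c (tnth y i0) by rewrite leNgt; apply/negP.
have xz : eucl_dist x z <= 2 * r.
  apply: (le_trans (eucl_dist_triangle c _ _)).
  have xc : eucl_dist x c < r by rewrite eucl_distC.
  have zc : eucl_dist c z < r by [].
  lra.
have ge_r w : eball c r w -> (1 + 2 * cs) * r <= sum_eucl_dist w y.
  move=> wB; apply: (@le_trans _ _ (eucl_dist w (tnth y i0))); last first.
    exact: eucl_dist_le_sum_eucl_dist.
  have := eucl_dist_triangle w c (tnth y i0).
  have wc : eucl_dist c w < r by [].
  lra.
have csr0 : 0 < cs * r by rewrite mulr_gt0.
set S := sum_eucl_dist x y; set Sz := sum_eucl_dist z y.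
have Sr : r <= S by have := ge_r x xB; rewrite -/S; lra.
have Szr : r <= Sz by have := ge_r z zB; rewrite -/Sz; lra.
have S0 : 0 < S by exact: lt_le_trans Sr.
have Sz0 : 0 < Sz by exact: lt_le_trans Szr.
have csS : cs * eucl_dist x z < S.
  have : cs * eucl_dist x z <= cs * (2 * r) by rewrite ler_pM2l.
  by have := ge_r x xB; rewrite -/S; lra.
have mr s : r <= s -> m%:R * eucl_dist x z <= 2 * m%:R * s.
  move=> rs; rewrite (mulrC 2) -mulrA ler_wpM2l//; apply: (le_trans xz).
  by rewrite ler_pM2l.
have SzS : Sz <= q * S.
  apply: (le_trans (sum_eucl_dist_le z x y)); rewrite -/S eucl_distC /q mulrDl mul1r.
  by rewrite lerD2l mr.
have SSz : S <= q * Sz.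
  apply: (le_trans (sum_eucl_dist_le x z y)); rewrite -/Sz /q mulrDl mul1r.
  by rewrite lerD2l mr.
have powS (u v : R) : S `^ u * S `^ v = S `^ (u + v).
  by rewrite -powRD// (gt_eqF S0) implybT.
pose Dx i := b i x - b i (tnth y i); pose Dz i := b i z - b i (tnth y i).
have Dx_le i : `|Dx i| <= Cb * S `^ delta.
  apply: (le_trans (Hb _ _ _)); rewrite ler_pM2l//.
  apply: ge0_ler_powR; rewrite ?nnegrE ?eucl_dist_ge0 ?(ltW d0) ?(ltW S0)//.
  exact: eucl_dist_le_sum_eucl_dist.
have qSd : (q * S) `^ delta = q `^ delta * S `^ delta.
  by rewrite powRM// ltW.
have Dx_le' i : `|Dx i| <= Cb * q `^ delta * S `^ delta.
  apply: (le_trans (Dx_le i)); rewrite -mulrA ler_pM2l// -qSd.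
  apply: ge0_ler_powR; rewrite ?nnegrE ?(ltW d0) ?(ltW S0) ?mulr_ge0 ?(ltW q0) ?(ltW S0)//.
  by rewrite ler_peMl// ltW.
have Dz_le i : `|Dz i| <= Cb * q `^ delta * S `^ delta.
  apply: (le_trans (Hb _ _ _)); rewrite -mulrA ler_pM2l// -qSd.
  apply: ge0_ler_powR; rewrite ?nnegrE ?eucl_dist_ge0 ?(ltW d0) ?mulr_ge0 ?(ltW q0) ?(ltW S0)//.
  by apply: le_trans SzS; exact: eucl_dist_le_sum_eucl_dist.
have Dxz i : `|Dx i - Dz i| <= Cb * 2 `^ delta * r `^ delta.
  have -> : Dx i - Dz i = b i x - b i z by rewrite /Dx /Dz; ring.
  apply: (le_trans (Hb _ _ _)); rewrite -mulrA ler_pM2l// -powRM ?(ltW r0)//.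
  by apply: ge0_ler_powR; rewrite ?nnegrE ?eucl_dist_ge0 ?(ltW d0) ?mulr_ge0 ?(ltW r0).
(* T1 uses the smoothness of the kernel and T2 that of the symbols. *)
have T1 : `|K x y - K z y| * \prod_i `|Dx i| <= C1 * r `^ delta * S `^ (- E).
  have h1 : `|K x y - K z y| <= Cs * (2 `^ gamma * r `^ delta) * S `^ (- (a + delta)).
    apply: (le_trans (Hs _ _ _ csS)); rewrite -mulrA ler_pM2l// -/S -powRN -/a.
    have -> : S `^ (- (a + delta)) = S `^ (gamma - delta) * S `^ (- (a + gamma)).
      by rewrite powS; congr (_ `^ _); ring.
    rewrite mulrA ler_pM2r ?powR_gt0//.
    apply: (@le_trans _ _ ((2 * r) `^ gamma)).
      apply: ge0_ler_powR; rewrite ?nnegrE ?eucl_dist_ge0 ?mulr_ge0 ?(ltW r0)//.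
      exact: ltW (lt_trans d0 dg).
    rewrite powRM ?(ltW r0)// -mulrA ler_pM2l ?powR_gt0//.
    have -> : r `^ gamma = r `^ delta * r `^ (gamma - delta).
      by rewrite -powRD ?(gt_eqF r0) ?implybT//; congr (_ `^ _); ring.
    rewrite ler_pM2l ?powR_gt0//.
    by apply: ge0_ler_powR; rewrite ?nnegrE ?(ltW r0) ?(ltW S0)// subr_ge0 ltW.
  have h2 : \prod_i `|Dx i| <= Cb ^+ m * S `^ (m%:R * delta).
    rewrite (mulrC m%:R) powRrM powR_mulrn ?powR_ge0// -exprMn.
    rewrite -[m in leRHS]card_ord -prodr_const.
    by apply: ler_prod => i _; rewrite normr_ge0 Dx_le.
  apply: (le_trans (ler_pM _ _ h1 h2)) => //; first by rewrite prodr_ge0.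
  have -> : S `^ (- E) = S `^ (- (a + delta)) * S `^ (m%:R * delta).
    by rewrite powS; congr (_ `^ _); rewrite /E esum /a; ring.
  rewrite /C1 le_eqVlt; apply/orP; left; apply/eqP.
  move: (S `^ _) (S `^ _) (Cb ^+ m) (2 `^ gamma) (r `^ delta) => u1 u2 u3 u4 u5; ring.
have T2 : `|K z y| * `|\prod_i Dx i - \prod_i Dz i| <= C2 * r `^ delta * S `^ (- E).
  have h1 : `|K z y| <= CK * q `^ a * S `^ (- a).
    apply: (le_trans (HK _ _ Sz0)); rewrite -mulrA ler_pM2l// -/Sz -/a.
    have -> : q `^ a * S `^ (- a) = (S / q) `^ (- a).
      rewrite powRM ?(ltW S0) ?invr_ge0 ?(ltW q0)// -[q^-1]powR_inv1 ?(ltW q0)//.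
      by rewrite -powRrM mulN1r opprK mulrC.
    apply: ler_powRN => //; first by rewrite divr_gt0.
    by rewrite ler_pdivrMr// mulrC.
  have h2 : `|\prod_i Dx i - \prod_i Dz i| <=
      m%:R * (Cb * 2 `^ delta * r `^ delta) * (Cb * q `^ delta * S `^ delta) ^+ m.-1.
    exact: prodr_diff_le.
  apply: (le_trans (ler_pM _ _ h1 h2)) => //.
  have -> : S `^ (- E) = S `^ (- a) * (S `^ delta) ^+ m.-1.
    rewrite -powR_mulrn ?powR_ge0// -powRrM powS; congr (_ `^ _).
    by rewrite /E esum -/a -{1}(prednK m0) -natr1; ring.
  rewrite /C2 exprMn le_eqVlt; apply/orP; left; apply/eqP.
  move: (S `^ (- a)) ((S `^ delta) ^+ m.-1) ((Cb * _) ^+ _) (2 `^ delta) (r `^ delta) (q `^ a).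
  move=> u1 u2 u3 u4 u5 u6; ring.
(* Each ball scale is at most 4 S, as r <= S. *)
have Srho : S `^ (- E) <= 4 `^ E * \prod_i (ball_scale c r (tnth y i) `^ e_ i)^-1.
  rewrite /E -prodr_powR_sum// -big_split/= -sumrN -prodr_powR_sum//.
  apply: ler_prod => i _; rewrite powR_ge0/= -powRN.
  set rho := ball_scale _ _ _; have rho0 : 0 < rho by exact: ball_scale_gt0.
  have -> : 4 `^ e_ i * rho `^ (- e_ i) = (rho / 4) `^ (- e_ i).
    rewrite powRM ?(ltW rho0) ?invr_ge0// -[4^-1]powR_inv1//.
    by rewrite -powRrM mulN1r opprK mulrC.
  apply: ler_powRN => //; first by rewrite divr_gt0.
  rewrite ler_pdivrMr//; apply: (le_trans (ball_scale_le n0 c (tnth y i) r0)).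
  have := eucl_dist_triangle x c (tnth y i).
  have xc : eucl_dist c x < r by [].
  have := eucl_dist_le_sum_eucl_dist x y i; rewrite -/S.
  lra.
rewrite big_split/=.
have F0 : 0 <= \prod_i `|f i (tnth y i)| by apply: prodr_ge0.
have -> : commutator_integrand K b f x y - commutator_integrand K b f z y =
    ((K x y - K z y) * \prod_i Dx i + K z y * (\prod_i Dx i - \prod_i Dz i)) *
    \prod_i f i (tnth y i).
  by rewrite /commutator_integrand !big_split/= -/(Dx _) -/(Dz _); ring.
have shuffle (u1 u2 u3 u4 u5 : R) : u1 * u2 * u3 * (u4 * u5) = u1 * u3 * (u2 * u5) * u4.
  ring.
rewrite shuffle normrM normr_prod; apply: ler_wpM2r => //.
apply: (@le_trans _ _ ((C1 + C2) * r `^ delta * S `^ (- E))); last first.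
  by apply: ler_wpM2l => //; rewrite mulr_ge0 ?powR_ge0// addr_ge0 ?(ltW C10) ?(ltW C20).
apply: (le_trans (ler_normD _ _)); rewrite !normrM normr_prod.
by rewrite mulrDl mulrDl; apply: lerD.
Qed.

End far_difference.

(** * Integrated estimates near and away from a ball *)

Section commutator_estimates.
Context {R : realType} {n m : nat}.
Variables (alpha gamma delta : R) (ps : 'I_m -> \bar R).
Variable K : euclid R n -> m.-tuple (euclid R n) -> R.
Variables (b v : 'I_m -> euclid R n -> R) (beta_ : 'I_m -> R).
Hypotheses (n0 : (0 < n)%N) (m0 : (0 < m)%N).
Hypothesis mK : measurable_fun setT
  (fun z : euclid R n * m.-tuple (euclid R n) => K z.1 z.2).
Hypothesis hsize : size_condition alpha K.
Hypothesis hsmooth : smoothness_condition alpha gamma K.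
Hypothesis hdelta : 0 < delta < gamma.
Hypothesis halpha : alpha + m%:R * delta < (m * n)%:R.
Hypothesis hps : forall i, (1 <= ps i)%E.
Hypothesis htau : (\sum_i fine (ps i)^-1) * n%:R < alpha + m%:R * delta.
Hypothesis hb : forall i, Lipschitz_space delta (b i).
Hypothesis hv : forall i, weight (v i).
Hypothesis hbeta : forall i, 0 < beta_ i < n%:R.
Hypothesis hbetasum : \sum_i beta_ i = alpha + m%:R * delta.
Hypothesis hRH : forall i, (1 < ps i)%E -> (1 < m)%N ->
  reverse_holder m%:R (fun x => v i x `^ (- fine (hoelder_conjugate (ps i)))).

(* e_ i is the exponent in the class of weights, tau i the reciprocal of the
   i-th exponent (0 for +oo) and - lam the degree of homogeneity of the
   commutator kernel. *)
Let e_ i : R := n%:R - beta_ i + delta / m%:R.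
Let tau i : R := fine (ps i)^-1.
Let lam : R := (m * n)%:R - alpha - m%:R * delta.

Let delta_gt0 : 0 < delta. Proof. by case/andP: hdelta. Qed.
Let lam0 : 0 < lam.
Proof. by rewrite /lam -addrA -opprD subr_gt0. Qed.
Let m0' : 0 < m%:R :> R. Proof. by rewrite ltr0n. Qed.

Let e_gt0 i : 0 < e_ i.
Proof.
have /andP[_ bn] := hbeta i.
by rewrite /e_ addr_gt0 ?divr_gt0// subr_gt0.
Qed.

Let e_sum : \sum_i e_ i = lam + delta.
Proof.
rewrite /e_ big_split/= sumrB hbetasum !sumr_const card_ord /lam.
rewrite -[delta / _ *+ _]mulr_natr divfK ?gt_eqF// -[n%:R *+ m]mulr_natr natrM.
ring.
Qed.

Let tau01 i : 0 <= tau i <= 1.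
Proof.
rewrite /tau; case: (ps i) (hps i) => [s| |] p1.
- have s1 : 1 <= s by rewrite -lee_fin.
  have s0 : 0 < s by exact: lt_le_trans s1.
  by rewrite inver gt_eqF//= invr_ge0 (ltW s0) invf_le1.
- by rewrite invey /= lexx ler01.
- by [].
Qed.

(** The norm of the class of weights attached to the [i]-th factor and a ball. *)
Definition weight_norm c (r : R) i : \bar R :=
  ('N[leb n]_(hoelder_conjugate (ps i))
    [EFin \o (fun z => (v i z)^-1 / ball_scale c r z `^ e_ i)%R])%E.

(** The norm of [f_i v_i] in [L^(p_i)]. *)
Definition function_norm (f : 'I_m -> euclid R n -> R) i : \bar R :=
  ('N[leb n]_(ps i)[EFin \o (fun x => f i x * v i x)%R])%E.

(** The families of functions to which the commutator is applied. *)
Definition admissible (f : 'I_m -> euclid R n -> R) :=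
  (forall i, measurable_fun setT (f i)) /\
  (forall i, (fun x => f i x * v i x) \in Lfun (leb n) (ps i)).

(** The quantity in terms of which both parts of the commutator are estimated;
    the factors are real numbers, all the norms being finite where it is used. *)
Definition norm_product c (r : R) f : R :=
  \prod_i (fine (function_norm f i) * fine (weight_norm c r i)).

(** The indicator function of the tuples whose entries all lie in [D]. *)
Definition indicator_tuple (D : set (euclid R n)) (y : m.-tuple (euclid R n)) : R :=
  \prod_i \1_D (tnth y i).

Lemma indicator_tuple_in D y : (forall i, D (tnth y i)) -> indicator_tuple D y = 1.
Proof.
by move=> Dy; rewrite /indicator_tuple big1// => i _; rewrite indicE mem_set.
Qed.

Lemma indicator_tuple_out D y : ~ (forall i, D (tnth y i)) -> indicator_tuple D y = 0.
Proof.
move=> /existsNP[i Di]; rewrite /indicator_tuple (bigD1 i)//= indicE memNset//.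
by rewrite mul0r.
Qed.

Lemma indicator_tuple01 D y : 0 <= indicator_tuple D y <= 1.
Proof.
have [h|h] := pselect (forall i, D (tnth y i)).
  by rewrite indicator_tuple_in// ler01 lexx.
by rewrite indicator_tuple_out// lexx ler01.
Qed.

Lemma measurable_indicator_tuple D : measurable D ->
  measurable_fun setT (indicator_tuple D).
Proof.
move=> mD; apply: (@measurable_prod _ _ _ _ _ _
  (fun i (y : m.-tuple (euclid R n)) => \1_D (tnth y i) : R)) => i _.
exact: (measurableT_comp (measurable_indic mD) (measurable_tnth i)).
Qed.

Lemma measurable_commutator_integrand f : (forall i, measurable_fun setT (f i)) ->
  measurable_fun setT (fun z : euclid R n * m.-tuple (euclid R n) =>
    commutator_integrand K b f z.1 z.2).
Proof.
move=> mf; apply: measurable_funM => //.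
apply: (@measurable_prod _ _ _ _ _ _ (fun i (z : euclid R n * m.-tuple (euclid R n)) =>
  (b i z.1 - b i (tnth z.2 i)) * f i (tnth z.2 i))) => i _.
have mb := measurable_Lipschitz delta_gt0 (hb i).
have mt : measurable_fun setT (fun z : euclid R n * m.-tuple (euclid R n) => tnth z.2 i).
  exact: (measurableT_comp (measurable_tnth i) measurable_snd).
apply: measurable_funM; last exact: (measurableT_comp (mf i) mt).
apply: measurable_funB; last exact: (measurableT_comp mb mt).
exact: (measurableT_comp mb measurable_fst).
Qed.

Lemma measurable_commutator_integrandx f x : (forall i, measurable_fun setT (f i)) ->
  measurable_fun setT (commutator_integrand K b f x).
Proof.
move=> mf.
exact: (measurableT_comp (measurable_commutator_integrand mf) (pair1_measurable x)).
Qed.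

(** The integrated estimates, near and away from the ball. The radius of the
    region of the variables [y_i] that is near to the ball is [kappa] times the
    radius of the ball, where [kappa] depends on the smoothness of the kernel. *)
Lemma commutator_estimates : exists kappa C : R, [/\ 0 < kappa, 0 < C &
  forall c (r : R) f, 0 < r -> admissible f ->
  (forall i, (0 < weight_norm c r i)%E) -> (forall i, (weight_norm c r i < +oo)%E) ->
  let D := eball c (kappa * r) in
  (forall x z, eball c r x -> eball c r z ->
    (\int[lebm n m]_y ((1 - indicator_tuple D y) *
      `|commutator_integrand K b f x y - commutator_integrand K b f z y|)%:E <=
     (C * r `^ delta * norm_product c r f)%:E)%E) /\
  (\int[leb n]_(x in eball c r) \int[lebm n m]_y
    (indicator_tuple D y * `|commutator_integrand K b f x y|)%:E <=
   (C * r `^ (n%:R + delta) * norm_product c r f)%:E)%E].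
Proof.
have [Cb [Cb0 HCb]] := Lipschitz_family hb.
have [CK [CK0 HCK]] := size_condition_pos hsize.
have [Cs [cs [Cs0 cs0 HCs]]] := hsmooth.
pose kappa := 2 + 2 * cs.
have k1 : 1 <= kappa by rewrite /kappa; lra.
have k0 : 0 < kappa by exact: lt_le_trans k1.
have mna0 : 0 <= (m * n)%:R - alpha.
  have : 0 < m%:R * delta by rewrite mulr_gt0.
  by have := lam0; rewrite /lam; lra.
have [Cf [Cf0 HCf]] := far_difference_le n0 m0 hdelta Cb0 CK0 Cs0 cs0 mna0 HCb HCK HCs
  (fun i => ltW (e_gt0 i)) e_sum.
(* The exponents of the near estimate: the Riesz kernels have the exponents
   om i, and eta > 0 is the room left by the hypothesis on 1/p. *)
pose T := \sum_i tau i.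
have hT : T * n%:R < alpha + m%:R * delta by exact: htau.
have T0 : 0 <= T by apply: sumr_ge0 => i _; case/andP: (tau01 i).
pose om i : R := 1 - (1 - m%:R^-1) * tau i.
pose theta : R := 1 - m%:R^-1.
have y01 : 0 <= theta <= 1.
  by rewrite /theta subr_ge0 invf_le1 ?ler1n// m0 /= gerBl invr_ge0 ltW.
have /andP[y0 y1] := y01.
have om0 i : 0 <= om i.
  have /andP[t0 t1] := tau01 i.
  by rewrite /om subr_ge0 -/theta mulr_ile1.
have om_sum : \sum_i om i = m%:R - theta * T.
  by rewrite /om sumrB sumr_const card_ord -mulr_sumr.
pose eta := alpha + m%:R * delta - n%:R * theta * T.
have eta0 : 0 < eta.
  rewrite /eta subr_gt0; apply: le_lt_trans hT.
  by rewrite mulrAC [leRHS]mulrC -mulrA ler_wpM2l// ler_piMr.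
have n0' : 0 < n%:R :> R by rewrite ltr0n.
pose eps := Num.min (eta / m%:R) (n%:R / 2).
have eps0 : 0 < eps by rewrite lt_min !divr_gt0.
have epsn : 0 < eps < n%:R.
  rewrite eps0/= /eps; apply: (@le_lt_trans _ _ (n%:R / 2)); first by rewrite ge_min lexx orbT.
  by rewrite ltr_pdivrMr// ltr_pMr// ltr1n.
(* With eps <= eta / m the product of the Riesz kernels is singular enough. *)
have lamle : lam <= (n%:R - eps) * \sum_i om i.
  have h1 : eps * m%:R <= eta by rewrite -ler_pdivlMr// /eps ge_min lexx.
  have h2 : eps * (m%:R - theta * T) <= eps * m%:R.
    by rewrite ler_wpM2l ?(ltW eps0)// lerBlDr lerDl mulr_ge0.
  have h3 : lam = n%:R * (m%:R - theta * T) - eta.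
    by rewrite /lam /eta natrM; ring.
  by rewrite om_sum mulrBl h3; lra.
have [Cn [Cn0 HCn]] := near_kernel_le m0 k1 epsn om0 lamle.
have anp : 0 < n%:R - eps < n%:R.
  by have /andP[? ?] := epsn; rewrite subr_gt0; apply/andP; split => //; rewrite gtrBl.
have [C0 [C00 HC0]] := integral_eucl_dist_powR anp.
have [Ci HCi] := choice (fun i =>
  factor_bounds n0 (hv i) (hps i) m0 (hRH (i := i)) k1 (e_gt0 i)).
have Ci0 i : 0 < Ci i by exact: (HCi i).1.
pose KK := Num.max 1 (C0 * (1 + kappa) `^ eps).
pose Cnear := CK * Cb ^+ m * Cn * (\prod_i Ci i) * (m%:R * KK ^+ m).
have KK1 : 1 <= KK by rewrite le_max lexx.
have KK0 : 0 < KK by exact: lt_le_trans KK1.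
have Cnear0 : 0 < Cnear.
  by rewrite !mulr_gt0 ?exprn_gt0// prodr_gt0.
exists kappa, (Cf + Cnear); split => //; first by rewrite addr_gt0.
move=> c r f r0 [mf fv] M0 Moo D.
have PM0 : 0 <= norm_product c r f.
  apply: prodr_ge0 => i _; rewrite mulr_ge0// fine_ge0//; last exact: ltW.
  exact: Lnorm_ge0.
have mD : measurable D by exact: measurable_eball.
have mB : measurable (eball c r) by exact: measurable_eball.
have mfrho i : measurable_fun setT (fun z => `|f i z| / ball_scale c r z `^ e_ i).
  apply: measurable_funM; first exact: measurableT_comp.
  apply: measurable_inv; apply: (measurableT_comp (measurable_powR _)).
  exact: measurable_ball_scale.
have FB i := (HCi i).2 c r (f i) r0 (mf i) (fv i) (M0 i) (Moo i).
split.
  move=> x z xB zB.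
  apply: (@le_trans _ _ (\int[lebm n m]_y ((Cf * r `^ delta)%:E *
      \prod_i (`|f i (tnth y i)| / ball_scale c r (tnth y i) `^ e_ i)%:E))%E).
    have mG : measurable_fun setT (fun y : m.-tuple (euclid R n) =>
        \prod_i (`|f i (tnth y i)| / ball_scale c r (tnth y i) `^ e_ i)).
      apply: (@measurable_prod _ _ _ _ _ _ (fun i (y : m.-tuple (euclid R n)) =>
        `|f i (tnth y i)| / ball_scale c r (tnth y i) `^ e_ i)) => i _.
      exact: (measurableT_comp (mfrho i) (measurable_tnth i)).
    apply: ge0_le_integral => //.
    - move=> y _; rewrite lee_fin mulr_ge0// subr_ge0.
      by case/andP: (indicator_tuple01 D y).
    - apply/measurable_EFinP; apply: measurable_funM.
        by apply: measurable_funB => //; exact: measurable_indicator_tuple.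
      apply: measurableT_comp => //; apply: measurable_funB;
        exact: measurable_commutator_integrandx.
    - apply: emeasurable_funM => //.
      rewrite (_ : (fun _ => _) = (fun y : m.-tuple (euclid R n) =>
        (\prod_i (`|f i (tnth y i)| / ball_scale c r (tnth y i) `^ e_ i))%:E)).
        exact/measurable_EFinP.
      by apply/funext => y; rewrite prodEFin.
    - move=> y _; rewrite prodEFin -EFinM lee_fin.
      have [h|h] := pselect (forall i, D (tnth y i)).
        rewrite indicator_tuple_in// subrr mul0r mulr_ge0//.
          by rewrite mulr_ge0 ?(ltW Cf0) ?powR_ge0.
        by apply: prodr_ge0 => i _; rewrite divr_ge0 ?powR_ge0.
      by rewrite indicator_tuple_out// subr0 mul1r; exact: HCf.
  rewrite ge0_integralZl_EFin//; last 3 first.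
  - by move=> y _; apply: prode_nonneg => i _; rewrite lee_fin divr_ge0 ?powR_ge0.
  - apply: (@emeasurable_prod _ _ _ _ (fun i (y : m.-tuple (euclid R n)) =>
      (`|f i (tnth y i)| / ball_scale c r (tnth y i) `^ e_ i)%:E)) => i.
    apply/measurable_EFinP; exact: (measurableT_comp (mfrho i) (measurable_tnth i)).
  - by rewrite mulr_ge0 ?(ltW Cf0) ?powR_ge0.
  rewrite (integral_tuple_prod (leb n) (F := fun i z =>
    (`|f i z| / ball_scale c r z `^ e_ i)%:E)); last 2 first.
  - by move=> i; apply/measurable_EFinP; exact: mfrho.
  - by move=> i u; rewrite lee_fin divr_ge0 ?powR_ge0.
  apply: (@le_trans _ _ ((Cf * r `^ delta)%:E * (norm_product c r f)%:E)%E).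
    apply: lee_wpmul2l; first by rewrite lee_fin mulr_ge0 ?(ltW Cf0) ?powR_ge0.
    rewrite /norm_product -prodEFin; apply: lee_prode => i _; apply/andP; split.
      by apply: integral_ge0 => u _; rewrite lee_fin divr_ge0 ?powR_ge0.
    exact: (FB i).1.
  rewrite -EFinM lee_fin; apply: ler_wpM2r => //; apply: ler_wpM2r; first exact: powR_ge0.
  by rewrite lerDl ltW.
have [H /choice[U HUP]] := choice (fun i => (FB i).2).
pose k (x y : euclid R n) : R := r `^ (- eps) * eucl_dist x y `^ (- (n%:R - eps)).
have k_ge0 x y : 0 <= k x y by rewrite mulr_ge0 ?powR_ge0.
have mk : measurable_fun setT (fun z : euclid R n * euclid R n => k z.1 z.2).
  apply: measurable_funM => //; apply: (measurableT_comp (measurable_powR _)).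
  exact: (measurable_fun_eucl_dist measurable_fst measurable_snd).
have kr0 : 0 < (1 + kappa) * r by rewrite mulr_gt0// addr_gt0.
(* Both balls lie in a ball of radius [(1 + kappa) r] about each other's points. *)
have int_k (A : set (euclid R n)) x : measurable A -> A `<=` eball x ((1 + kappa) * r) ->
    (\int[leb n]_(y in A) (k x y)%:E <= KK%:E)%E.
  move=> mA AB.
  have mdx : measurable_fun setT (fun y => (eucl_dist x y `^ (- (n%:R - eps)))%:E : \bar R).
    apply/measurable_EFinP; apply: (measurableT_comp (measurable_powR _)).
    exact: (measurable_fun_eucl_dist (measurable_cst x) (@measurable_id _ _ _)).
  rewrite /k; under eq_integral do rewrite EFinM.
  rewrite ge0_integralZl_EFin ?powR_ge0//; last 2 first.
  - by move=> y _; rewrite lee_fin powR_ge0.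
  - exact: measurable_funTS.
  apply: (@le_trans _ _ ((r `^ (- eps))%:E * (C0 * ((1 + kappa) * r) `^ eps)%:E)%E).
    apply: lee_wpmul2l; first by rewrite lee_fin powR_ge0.
    apply: (@le_trans _ _ (\int[leb n]_(y in eball x ((1 + kappa) * r))
      (eucl_dist x y `^ (- (n%:R - eps)))%:E)%E).
      apply: ge0_subset_integral => //; first exact: measurable_eball.
      - exact: measurable_funTS.
      - by move=> y _; rewrite lee_fin powR_ge0.
    have := HC0 x _ kr0; rewrite (_ : n%:R - (n%:R - eps) = eps) //; ring.
  have k10 : 0 <= 1 + kappa by rewrite addr_ge0 ?(ltW k0).
  rewrite -EFinM lee_fin /KK le_max; apply/orP; right.
  rewrite powRM ?(ltW r0)//.
  rewrite [leLHS](_ : _ = C0 * (1 + kappa) `^ eps * (r `^ (- eps) * r `^ eps)); last by ring.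
  by rewrite -powRD ?(gt_eqF r0) ?implybT// addNr powRr0 mulr1.
have kE : (1 + kappa) * r = r + kappa * r by ring.
have kD x : eball c r x -> (\int[leb n]_(y in D) (k x y)%:E <= KK%:E)%E.
  move=> xB; apply: int_k => //; apply: eball_subset.
  by rewrite kE lerD2r eucl_distC ltW.
have kB y : D y -> (\int[leb n]_(x in eball c r) (k x y)%:E <= KK%:E)%E.
  move=> yD; under eq_integral do rewrite /k eucl_distC.
  apply: int_k => //; apply: eball_subset.
  by rewrite kE addrC lerD2l eucl_distC ltW.
have form_le := @multilinear_form_le _ _ R (leb n) m (eball c r) D k KK H U tau m0 mB mD mk
  k_ge0 KK1 kD kB.
have mH i : measurable_fun setT (H i) by have [[]] := HUP i.
have mU i : measurable_fun setT (U i) by have [[]] := HUP i.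
have H0 i z : 0 <= H i z by have [_ []] := HUP i.
have U0 i z : 0 <= U i z by have [_ []] := HUP i.
have H1 i : (\int[leb n]_z (H i z)%:E <= 1)%E by have [_ _] := HUP i.
have U1 i : (\int[leb n]_z (U i z)%:E <= 1)%E by have [_ _ _] := HUP i.
have {}form_le := form_le mH mU H0 U0 H1 U1 tau01.
pose A i := Ci i * (fine (function_norm f i) * fine (weight_norm c r i)) *
  r `^ (e_ i - n%:R * (1 - tau i) * (1 - m%:R^-1)).
have fA i : {ae leb n, forall z, D z ->
    `|f i z| <= A i * (H i z `^ tau i * U i z `^ ((1 - tau i) / m%:R))}.
  by have [_ _ _ _ ae5] := HUP i.
have hM0 i : 0 <= fine (function_norm f i) * fine (weight_norm c r i).
  by rewrite mulr_ge0// fine_ge0//; [exact: Lnorm_ge0|exact: ltW].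
have A0 i : 0 <= A i.
  by rewrite /A mulr_ge0 ?powR_ge0// mulr_ge0// ltW.
have {HUP FB} aeA := ae_tuple fA.
pose X x (y : m.-tuple (euclid R n)) : R := \prod_i (\1_D (tnth y i) *
  (k x (tnth y i) `^ om i * (H i (tnth y i) `^ tau i * U i (tnth y i) `^ ((1 - tau i) / m%:R)))).
have X0 x y : 0 <= X x y.
  by apply: prodr_ge0 => i _; rewrite !mulr_ge0 ?powR_ge0.
pose Cst := CK * Cb ^+ m * (Cn * r `^ (n%:R * (\sum_i om i) - lam)) * \prod_i A i.
have Cst0 : 0 <= Cst.
  rewrite !mulr_ge0 ?powR_ge0 ?exprn_ge0 ?(ltW CK0) ?(ltW Cb0) ?(ltW Cn0)//.
  exact: prodr_ge0.
(* The powers of r add up to n + delta. *)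
have CstE : Cst = CK * Cb ^+ m * Cn * (\prod_i Ci i) * r `^ (n%:R + delta) * norm_product c r f.
  have prodA : \prod_i A i = (\prod_i Ci i) * norm_product c r f *
      r `^ (\sum_i (e_ i - n%:R * (1 - tau i) * (1 - m%:R^-1))).
    by rewrite -prodr_powR_sum// /norm_product -!big_split.
  rewrite /Cst prodA.
  have -> : r `^ (n%:R + delta) = r `^ (n%:R * (\sum_i om i) - lam) *
      r `^ (\sum_i (e_ i - n%:R * (1 - tau i) * (1 - m%:R^-1))).
    rewrite -powRD ?(gt_eqF r0) ?implybT//; congr (_ `^ _).
    rewrite om_sum sumrB e_sum -mulr_suml -mulr_sumr sumrB sumr_const card_ord -/T.
    by rewrite /theta; field; rewrite gt_eqF.
  move: (r `^ _) (r `^ _) (norm_product c r f) (\prod_i Ci i) (Cb ^+ m).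
  by move=> u1 u2 u3 u4 u5; ring.
have X_le x : eball c r x -> {ae lebm n m, forall y,
    indicator_tuple D y * `|commutator_integrand K b f x y| <= Cst * X x y}.
  move=> xB; apply: filterS aeA => y fy.
  have [Dy|nDy] := pselect (forall i, D (tnth y i)); last first.
    by rewrite indicator_tuple_out// mul0r mulr_ge0.
  rewrite indicator_tuple_in// mul1r.
  (* If x is one of the y_i then the integrand vanishes; this case is separate
     because 0 `^ a = 0 for negative a also. *)
  have [[i di]|nd] := pselect (exists i, eucl_dist x (tnth y i) = 0).
    have bi : b i x - b i (tnth y i) = 0.
      apply/eqP; rewrite -normr_eq0 eq_le normr_ge0 andbT.
      by apply: (le_trans (HCb _ _ _)); rewrite di powR0 ?mulr0// gt_eqF.
    have -> : commutator_integrand K b f x y = 0.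
      by rewrite /commutator_integrand (bigD1 i)//= bi !mul0r mulr0.
    by rewrite normr0 mulr_ge0.
  have d0 i : 0 < eucl_dist x (tnth y i).
    by rewrite lt0r eucl_dist_ge0 andbT; apply/eqP => di; apply: nd; exists i.
  apply: (le_trans (commutator_integrand_le f m0 (ltW Cb0) (ltW CK0) delta_gt0 HCb HCK x y)).
  have Xy : X x y = \prod_i k x (tnth y i) `^ om i *
      \prod_i (H i (tnth y i) `^ tau i * U i (tnth y i) `^ ((1 - tau i) / m%:R)).
    rewrite /X -big_split/=; apply: eq_bigr => i _.
    by rewrite indicE mem_set ?mul1r//; exact: Dy.
  have near_le := HCn c r x y r0 xB Dy d0.
  have f_le : \prod_i `|f i (tnth y i)| <= \prod_i A i *
      \prod_i (H i (tnth y i) `^ tau i * U i (tnth y i) `^ ((1 - tau i) / m%:R)).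
    by rewrite -big_split/=; apply: ler_prod => i _; rewrite normr_ge0 fy//; exact: Dy.
  rewrite Xy /Cst.
  have shuffle (u1 u2 u3 u4 u5 : R) : u1 * u2 * u3 * (u4 * u5) = u1 * (u2 * u4) * (u3 * u5).
    by ring.
  rewrite shuffle; apply: ler_pM => //.
  - by rewrite !mulr_ge0 ?powR_ge0 ?exprn_ge0 ?(ltW CK0) ?(ltW Cb0).
  - exact: prodr_ge0.
  - by apply: ler_wpM2l near_le; rewrite mulr_ge0 ?exprn_ge0 ?(ltW CK0) ?(ltW Cb0).
have mX : measurable_fun setT (fun z : euclid R n * m.-tuple (euclid R n) => X z.1 z.2).
  apply: (@measurable_prod _ _ _ _ _ _ (fun i (z : euclid R n * m.-tuple (euclid R n)) =>
    \1_D (tnth z.2 i) * (k z.1 (tnth z.2 i) `^ om i *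
    (H i (tnth z.2 i) `^ tau i * U i (tnth z.2 i) `^ ((1 - tau i) / m%:R))))) => i _.
  have mt : measurable_fun setT (fun z : euclid R n * m.-tuple (euclid R n) => tnth z.2 i).
    exact: (measurableT_comp (measurable_tnth i) measurable_snd).
  have mzt : measurable_fun setT
      (fun z : euclid R n * m.-tuple (euclid R n) => (z.1, tnth z.2 i)).
    exact/measurable_fun_pair.
  apply: measurable_funM; first exact: (measurableT_comp (measurable_indic mD) mt).
  apply: measurable_funM.
    exact: (measurableT_comp (measurable_powR _) (measurableT_comp mk mzt)).
  apply: measurable_funM; apply: (measurableT_comp (measurable_powR _)).
    exact: (measurableT_comp (mH i) mt).
  exact: (measurableT_comp (mU i) mt).
have mgE := measurable_commutator_integrand mf.
have mig : measurable_fun setT (fun z : euclid R n * m.-tuple (euclid R n) =>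
    (indicator_tuple D z.2 * `|commutator_integrand K b f z.1 z.2|)%:E).
  apply/measurable_EFinP; apply: measurable_funM; last exact: measurableT_comp.
  exact: (measurableT_comp (measurable_indicator_tuple mD) measurable_snd).
have ig0 x y : (0 <= (indicator_tuple D y * `|commutator_integrand K b f x y|)%:E)%E.
  by rewrite lee_fin mulr_ge0//; case/andP: (indicator_tuple01 D y).
have mintX : measurable_fun setT (fun x => \int[lebm n m]_y (X x y)%:E)%E.
  apply: (@measurable_fun_fubini_tonelli_F _ _ _ _ _ (lebm n m)
    (fun z : euclid R n * m.-tuple (euclid R n) => (X z.1 z.2)%:E)).
    exact/measurable_EFinP.
  by move=> z; rewrite lee_fin.
apply: (@le_trans _ _ (\int[leb n]_(x in eball c r) (Cst%:E * \int[lebm n m]_y (X x y)%:E))%E).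
  apply: ge0_le_integral => //.
  - by move=> x _; apply: integral_ge0.
  - apply: measurable_funTS.
    exact: (@measurable_fun_fubini_tonelli_F _ _ _ _ _ (lebm n m)
      (fun z : euclid R n * m.-tuple (euclid R n) =>
        (indicator_tuple D z.2 * `|commutator_integrand K b f z.1 z.2|)%:E)).
  - by apply: emeasurable_funM => //; exact: measurable_funTS.
  move=> x xB; have mXx : measurable_fun setT (X x).
    exact: (measurableT_comp mX (pair1_measurable x)).
  rewrite -ge0_integralZl_EFin//; last 2 first.
  - by move=> y _; rewrite lee_fin.
  - exact/measurable_EFinP.
  apply: ae_ge0_le_integral => //.
  - exact: (measurableT_comp mig (pair1_measurable x)).
  - by move=> y _; rewrite -EFinM lee_fin mulr_ge0.
  - by apply: emeasurable_funM => //; exact/measurable_EFinP.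
  - by apply: filterS (X_le x xB) => y Xy _; rewrite -EFinM lee_fin.
rewrite ge0_integralZl_EFin//; last 2 first.
- by move=> x _; apply: integral_ge0 => y _; rewrite lee_fin.
- exact: measurable_funTS.
apply: (@le_trans _ _ (Cst%:E * (m%:R * KK ^+ m)%:E)%E).
  by apply: lee_wpmul2l; [rewrite lee_fin|exact: form_le].
rewrite -EFinM lee_fin CstE [leRHS](_ : _ = Cf * r `^ (n%:R + delta) * norm_product c r f +
    Cnear * r `^ (n%:R + delta) * norm_product c r f); last by ring.
rewrite -[leLHS]add0r; apply: lerD; first by rewrite !mulr_ge0 ?powR_ge0 ?(ltW Cf0).
rewrite /Cnear le_eqVlt; apply/orP; left; apply/eqP.
move: (r `^ _) (\prod_i _) (norm_product c r f) (Cb ^+ m) (KK ^+ m) => u1 u2 u3 u4 u5; ring.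
Qed.

End commutator_estimates.

(** * Integrals depending on a parameter *)

Section parametric_integral.
Context d1 d2 (T1 : measurableType d1) (T2 : measurableType d2) (R : realType).
Variable mu : {sigma_finite_measure set T2 -> \bar R}.

Lemma measurable_fun_Rintegral (h : T1 * T2 -> R) : measurable_fun setT h ->
  measurable_fun setT (fun x => \int[mu]_y h (x, y)).
Proof.
move=> mh; apply: (@measurableT_comp _ _ _ _ _ _ (@fine R)); first exact: fine_measurable.
pose hp := ((EFin \o h)^\+)%E; pose hn := ((EFin \o h)^\-)%E.
have mEh : measurable_fun setT (EFin \o h) by exact/measurable_EFinP.
rewrite (_ : (fun _ => _) = (fun x => (\int[mu]_y hp (x, y))%E) \-
    (fun x => (\int[mu]_y hn (x, y))%E))%E; last first.
  apply/funext => x; rewrite integralE.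
  by congr (_ - _)%E; apply: eq_integral => y _; rewrite /hp /hn !(funeposE, funenegE).
apply: emeasurable_funB.
- apply: (@measurable_fun_fubini_tonelli_F _ _ _ _ _ mu hp).
    exact: measurable_funepos.
  by move=> z; exact: funepos_ge0.
- apply: (@measurable_fun_fubini_tonelli_F _ _ _ _ _ mu hn).
    exact: measurable_funeneg.
  by move=> z; exact: funeneg_ge0.
Qed.

(** The value of a divergent integral in the extended reals is infinite, and
    [fine] sends it to [0]. *)
Lemma Rintegral_not_integrable (h : T2 -> R) : measurable_fun setT h ->
  ~ mu.-integrable setT (EFin \o h) -> \int[mu]_y h y = 0.
Proof.
move=> mh nih; rewrite /Rintegral integralE.
have mEh : measurable_fun setT (EFin \o h) by exact/measurable_EFinP.
set a := (\int[mu]_y _)%E; set c := (\int[mu]_y _)%E.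
have a0 : (0 <= a)%E by apply: integral_ge0.
have c0 : (0 <= c)%E by apply: integral_ge0.
have acoo : (a + c = +oo)%E.
  apply: contrapT => ac; apply: nih; apply/integrableP; split => //.
  have -> : (\int[mu]_x `|(EFin \o h) x| = a + c)%E.
    rewrite /a /c -ge0_integralD//; last 2 first.
    - exact: measurable_funepos.
    - exact: measurable_funeneg.
    by apply: eq_integral => x _; have := congr1 (@^~ x) (fune_abse (EFin \o h)).
  by rewrite ltey; apply/eqP.
move: a c a0 c0 acoo => [a| |] [c| |]//.
Qed.

End parametric_integral.

Section modulo_constants.
Context d (T : measurableType d) (R : realType) (mu : {sigma_finite_measure set T -> \bar R}).

Let diff_integrable (g g' : T -> R) :=
  mu.-integrable setT (EFin \o (fun y => g y - g' y)).

Lemma integrable_of_difference (g g' : T -> R) :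
  mu.-integrable setT (EFin \o g') -> diff_integrable g g' -> mu.-integrable setT (EFin \o g).
Proof.
move=> ig' id; have := integrableD measurableT id ig'.
apply: eq_integrable => // y _ /=.
by rewrite -EFinD subrK.
Qed.

Lemma Rintegral_difference_le (g g' : T -> R) : diff_integrable g g' ->
  (`|\int[mu]_y (g y - g' y)|%:E <= \int[mu]_y `|g y - g' y|%:E)%E.
Proof.
move=> id; rewrite -(@fineK _ (\int[mu]_y `|g y - g' y|%:E)%E); last first.
  by apply: integrable_fin_num => //; exact: (integrable_norm id).
by rewrite lee_fin; exact: le_normr_Rintegral.
Qed.

End modulo_constants.

(** * Consequences of the class of weights *)

Section weight_class_consequences.
Context {R : realType} {n m : nat}.
Hypotheses (n0 : (0 < n)%N).

Lemma integral_inverse_weight_gt0 (w : euclid R n -> R) c (r : R) : 0 < r ->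
  weight w -> loc_integrable (fun x => (w x)^-1) ->
  (0 < \int[leb n]_(x in eball c r) (w x)^-1%:E < +oo)%E.
Proof.
move=> r0 [_ w0] [mw iw].
have mB := measurable_eball c r.
have E : (\int[leb n]_(x in eball c r) (w x)^-1%:E =
    \int[leb n]_(x in eball c r) `|(w x)^-1|%:E)%E.
  apply: ae_eq_integral => //.
  - by apply/measurable_EFinP; exact: measurable_funTS.
  - by apply/measurable_EFinP; apply: measurableT_comp => //; exact: measurable_funTS.
  - by apply: filterS w0 => x wx _; rewrite ger0_norm// invr_ge0 ltW.
have [_ ioo] := integrableP _ _ _ (iw c r); rewrite E; apply/andP; split; last exact: ioo.
rewrite lt0e integral_ge0// andbT; apply/eqP => I0.
have /ae_eq_integral_abs : measurable_fun (eball c r) (EFin \o (fun x => (w x)^-1)).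
  by apply/measurable_EFinP; exact: measurable_funTS.
move=> /(_ (leb n) mB)[+ _] => /(_ I0) ae0.
have [x [xB [wx x0]]] : exists x, eball c r x /\ (0 < w x /\
    (eball c r x -> (EFin \o (fun x => (w x)^-1)) x = cst 0%E x)).
  apply: (ae_nonempty (mu := leb n)) => //; first exact: leb_eball_gt0.
  by apply: filterS2 w0 ae0 => x ? ?; split.
have [/eqP] := x0 xB; rewrite invr_eq0 => /eqP wx0.
by move: wx; rewrite wx0 ltxx.
Qed.

(** Positivity of each norm, needed to deduce from the finiteness of their product
    that of each of them. *)
Lemma weight_norm_gt0 (delta : R) (ps : 'I_m -> \bar R) (v : 'I_m -> euclid R n -> R)
    (beta_ : 'I_m -> R) c (r : R) i : 0 < r -> (1 <= ps i)%E -> weight (v i) ->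
  (0 < weight_norm delta ps v beta_ c r i)%E.
Proof.
move=> r0 p1 wv; have [_ v0] := wv.
rewrite lt0e Lnorm_ge0 andbT; apply/eqP => N0.
rewrite /weight_norm in N0; set phi := EFin \o _ in N0.
have mphi : measurable_fun setT phi.
  apply/measurable_EFinP; apply: measurable_funM.
    by apply: measurable_inv; exact: measurable_weight.
  apply: measurable_inv; apply: (measurableT_comp (measurable_powR _)).
  exact: measurable_ball_scale.
have p0 : (0 < hoelder_conjugate (ps i))%E.
  by apply: lt_le_trans (hoelder_conj_ge1 p1); rewrite lte01.
have ae0 := Lnorm_eq0_eq0 mphi p0 N0.
have [x [_ [vx x0]]] : exists x, [set: euclid R n] x /\ (0 < v i x /\
    ([set: euclid R n] x -> phi x = \0 x)%E).
  apply: (ae_nonempty (mu := leb n)) => //; first exact: leb_setT_gt0.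
  by apply: filterS2 v0 ae0 => x ? ?; split.
have := x0 I; rewrite /phi /= => -[/eqP]; rewrite mulf_eq0 !invr_eq0 => /orP[] /eqP h.
  by move: vx; rewrite h ltxx.
by have := powR_gt0 (n%:R - beta_ i + delta / m%:R) (ball_scale_gt0 n0 c x r0); rewrite h ltxx.
Qed.

Lemma prode_lty (I : finType) (a : I -> \bar R) : (forall i, 0 < a i)%E ->
  (\prod_i a i < +oo)%E -> forall i, (a i < +oo)%E.
Proof.
move=> a0 + i; rewrite (bigD1 i)//= ltey => h; rewrite ltey; apply: contra h => /eqP ->.
rewrite gt0_mulye//.
by elim/big_ind: _ => // x y; exact: mule_gt0.
Qed.

Lemma fine_prode (I : finType) (a : I -> \bar R) : (forall i, a i \is a fin_num) ->
  (\prod_i fine (a i))%:E = (\prod_i a i)%E.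
Proof. by move=> af; rewrite -prodEFin; apply: eq_bigr => i _; rewrite fineK. Qed.

(** The condition of the class of weights, with [|B|^(1 + delta / n)] bounded
    below by a multiple of [r^(n + delta)]; it makes every norm finite. *)
Lemma weight_class_radius (delta dt C : R) (ps : 'I_m -> \bar R)
    (w : euclid R n -> R) (v : 'I_m -> euclid R n -> R) (beta_ : 'I_m -> R) :
  0 < delta -> 0 < C -> (forall i, (1 <= ps i)%E) -> (forall i, weight (v i)) ->
  weight w -> loc_integrable (fun x => (w x)^-1) ->
  (forall c (r : R), 0 < r ->
    (leb n (eball c r) `^ (1 + (delta - dt) / n%:R) /
      (\int[leb n]_(x in eball c r) (w x)^-1%:E) *
      \prod_(i < m) weight_norm delta ps v beta_ c r i <= C%:E)%E) ->
  exists C' : R, 0 < C' /\ forall c (r : R), 0 < r ->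
    (forall i, (weight_norm delta ps v beta_ c r i < +oo)%E) /\
    r `^ (n%:R + delta) * \prod_(i < m) fine (weight_norm delta ps v beta_ c r i) <=
    C' * (fine (\int[leb n]_(x in eball c r) (w x)^-1%:E) *
          fine (leb n (eball c r)) `^ (dt / n%:R)).
Proof.
move=> d0 C0 hps hv hw hiw HC.
have n0' : 0 < n%:R :> R by rewrite ltr0n.
pose s := 1 + delta / n%:R; have s0 : 0 < s by rewrite addr_gt0// divr_gt0.
pose k : R := (2 / n%:R) ^+ n; have k0 : 0 < k by rewrite exprn_gt0// divr_gt0.
exists (C * k `^ (- s)); split; first by rewrite mulr_gt0// powR_gt0.
move=> c r r0; have := HC c r r0.
have /andP[W0 Woo] := integral_inverse_weight_gt0 c r0 hw hiw.
set W := (\int[leb n]_(x in _) _)%E in W0 Woo *.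
have WK : (fine W)%:E = W by rewrite fineK// gt0_fin_numE.
have fW0 : 0 < fine W by rewrite fine_gt0// W0.
set V := fine (leb n (eball c r)); have V0 : 0 < V by exact: fine_leb_eball_gt0.
have wn0 i := weight_norm_gt0 delta beta_ c r0 (hps i) (hv i).
rewrite -(leb_eball_fineK c r0) -/V poweR_EFin -WK inver gt_eqF// -EFinM.
set t := 1 + (delta - dt) / n%:R.
have tW0 : 0 < V `^ t / fine W by rewrite divr_gt0// powR_gt0.
move=> H.
have wnoo : forall i, (weight_norm delta ps v beta_ c r i < +oo)%E.
  apply: prode_lty wn0 _; rewrite ltey; apply/eqP => Poo.
  by move: H; rewrite Poo gt0_muley ?lte_fin// leye_eq.
split => //; move: H.
rewrite -fine_prode; last by move=> i; rewrite gt0_fin_numE.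
rewrite -EFinM lee_fin; set P := \prod_i _ => H.
have P0 : 0 <= P by apply: prodr_ge0 => i _; rewrite fine_ge0// ltW.
have rV : r `^ (n%:R + delta) <= k `^ (- s) * V `^ s.
  have -> : r `^ (n%:R + delta) = (r ^+ n) `^ s.
    rewrite -powR_mulrn ?(ltW r0)// -powRrM; congr (_ `^ _).
    by rewrite /s; field; rewrite gt_eqF.
  have -> : k `^ (- s) * V `^ s = (V / k) `^ s.
    rewrite powRM ?(ltW V0) ?invr_ge0 ?(ltW k0)// -[k^-1]powR_inv1 ?(ltW k0)//.
    by rewrite -powRrM mulN1r mulrC.
  apply: ge0_ler_powR; rewrite ?nnegrE ?(ltW s0) ?exprn_ge0 ?divr_ge0 ?(ltW r0)
    ?(ltW V0) ?(ltW k0)//.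
  rewrite ler_pdivlMr// mulrC /k -exprMn -lee_fin leb_eball_fineK//.
  have := leb_eball_ge c r0 n0; rewrite (_ : 2 * (r / n%:R) = 2 / n%:R * r)//.
  by rewrite mulrA mulrAC.
apply: (le_trans (ler_wpM2r P0 rV)).
have Vs : V `^ s = V `^ t * V `^ (dt / n%:R).
  rewrite -powRD ?(gt_eqF V0) ?implybT//; congr (_ `^ _).
  by rewrite /s /t; field; rewrite gt_eqF.
have {}H : V `^ t * P <= C * fine W.
  by rewrite -ler_pdivrMr// mulrAC.
rewrite Vs [leLHS](_ : _ = k `^ (- s) * V `^ (dt / n%:R) * (V `^ t * P)); last by ring.
rewrite [leRHS](_ : _ = k `^ (- s) * V `^ (dt / n%:R) * (C * fine W)); last by ring.
by apply: ler_wpM2l H; rewrite mulr_ge0 ?powR_ge0.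
Qed.

End weight_class_consequences.

(** * Boundedness of the product commutator *)

Theorem theorem1p2 (R : realType) (n m : nat)
  (alpha gamma delta dt : R)
  (p : \bar R) (ps : 'I_m -> \bar R)
  (K : euclid R n -> m.-tuple (euclid R n) -> R)
  (b v : 'I_m -> euclid R n -> R) (w : euclid R n -> R)
  (halpha : 0 < alpha < (m * n)%:R)
  (hK : measurable_fun setT
          (fun z : euclid R n * m.-tuple (euclid R n) => K z.1 z.2))
  (hsize : size_condition alpha K)
  (hgamma : 0 < gamma <= 1)
  (hsmooth : smoothness_condition alpha gamma K)
  (hdelta : 0 < delta < Num.min gamma (((m * n)%:R - alpha) / m%:R))
  (hps : forall i, (1 <= ps i)%E)
  (hp : (p^-1 = \sum_(i < m) (ps i)^-1)%E)
  (hpn : ((n%:R / (alpha + m%:R * delta))%:E < p)%E)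
  (hb : forall i, Lipschitz_space delta (b i))
  (hdt : dt <= delta)
  (hw : weight w)
  (hv : forall i, weight (v i))
  (hH : weight_class ps (alpha + m%:R * delta) delta dt w v)
  (hRH : forall i, (1 < ps i)%E -> (1 < m)%N ->
    reverse_holder m%:R
      (fun x => v i x `^ (- fine (hoelder_conjugate (ps i))))) :
  exists C : R, 0 < C /\
  forall f : 'I_m -> euclid R n -> R,
    (forall i, measurable_fun setT (f i)) ->
    (forall i, (fun x => f i x * v i x) \in Lfun (leb n) (ps i)) ->
    let bounded_oscillation (F : euclid R n -> R) :=
      loc_integrable F /\
      forall (c : euclid R n) (r : R), 0 < r ->
        (weighted_oscillation w dt F (eball c r) <=
         C%:E * \prod_(i < m) 'N[leb n]_(ps i)
                  [EFin \o (fun x => f i x * v i x)%R])%E in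
    bounded_oscillation (product_commutator K b f) /\
    exists F, commutator_mod_constants K b f F /\ bounded_oscillation F.
Proof.
have /andP[alpha0 alphamn] := halpha.
have mn0 : (0 < m * n)%N by rewrite -(ltr0n R); exact: lt_trans alphamn.
have m0 : (0 < m)%N by move: mn0; rewrite muln_gt0 => /andP[].
have n0 : (0 < n)%N by move: mn0; rewrite muln_gt0 => /andP[].
have m0' : 0 < m%:R :> R by rewrite ltr0n.
have n0' : 0 < n%:R :> R by rewrite ltr0n.
have /andP[delta0 hd] := hdelta.
have dg : 0 < delta < gamma.
  by rewrite delta0 (lt_le_trans hd)// ge_min lexx.
have amd : alpha + m%:R * delta < (m * n)%:R.
  have : delta < ((m * n)%:R - alpha) / m%:R by rewrite (lt_le_trans hd)// ge_min lexx orbT.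
  by rewrite ltr_pdivlMr// mulrC ltrBrDl.
have amd0 : 0 < alpha + m%:R * delta by rewrite addr_gt0// mulr_gt0.
have htau : (\sum_i fine (ps i)^-1) * n%:R < alpha + m%:R * delta.
  have pinv : p^-1%E = (\sum_i fine (ps i)^-1)%:E.
    rewrite hp -sumEFin; apply: eq_bigr => i _; rewrite fineK//.
    case: (ps i) (hps i) => [s| |] s1.
    - by rewrite inver gt_eqF// (@lt_le_trans _ _ 1)// -lee_fin.
    - by rewrite invey.
    - by [].
  case: p hpn pinv {hp} => [s| |]; last by rewrite ltNge leNye.
  - rewrite lte_fin => ns; have s0 : 0 < s by apply: lt_trans ns; rewrite divr_gt0.
    rewrite inver gt_eqF// => -[<-].
    by rewrite mulrC ltr_pdivrMr// -ltr_pdivrMl// mulrC.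
  - by rewrite invey => _ [<-]; rewrite mul0r.
have [iw [beta_ [C0 [hbeta hbsum C00 HC0]]]] := hH.
have [kappa [C1 [k0 C10 EST]]] := commutator_estimates n0 m0 hK hsize hsmooth dg amd
  hps htau hb hv hbeta hbsum hRH.
have [C2 [C20 RAD]] := weight_class_radius n0 delta0 C00 hps hv hw iw HC0.
pose CC := C1 * (2 + 2 ^+ n) * C2.
have CC0 : 0 < CC by rewrite !mulr_gt0// addr_gt0// exprn_gt0.
exists CC; split => // f mf fv bounded_oscillation.
have adm : admissible ps v f by split.
pose g := commutator_integrand K b f.
pose nrm i : \bar R := function_norm ps v f i.
have nrm_fin i : nrm i \is a fin_num.
  by rewrite ge0_fin_numE ?Lnorm_ge0//; have /andP[_] := fv i; rewrite inE.
have mg : measurable_fun setT (fun z : euclid R n * m.-tuple (euclid R n) => g z.1 z.2).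
  exact: (measurable_commutator_integrand hK dg hb mf).
have mgx x : measurable_fun setT (g x).
  exact: (measurableT_comp mg (pair1_measurable x)).
pose D c (r : R) := eball c (kappa * r) : set (euclid R n).
have mD c r : measurable (D c r) by exact: measurable_eball.
pose near c (r : R) x : \bar R :=
  (\int[lebm n m]_y (indicator_tuple (D c r) y * `|g x y|)%:E)%E.
pose far c (r : R) : R := C1 * r `^ delta * norm_product delta ps v beta_ c r f.
have wn0 c r i : 0 < r -> (0 < weight_norm delta ps v beta_ c r i)%E.
  by move=> r0; exact: weight_norm_gt0.
have PM0 c r : 0 < r -> 0 <= norm_product delta ps v beta_ c r f.
  move=> r0; apply: prodr_ge0 => i _; rewrite mulr_ge0// fine_ge0//.
    exact: Lnorm_ge0.
  by apply: ltW; exact: wn0.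
have far0 c r : 0 < r -> 0 <= far c r.
  by move=> r0; rewrite !mulr_ge0 ?powR_ge0 ?PM0// ltW.
have near_ge0 c r x : (0 <= near c r x)%E.
  apply: integral_ge0 => y _; rewrite lee_fin mulr_ge0//.
  by case/andP: (indicator_tuple01 (D c r) y).
have mnear c r : measurable_fun setT (near c r).
  apply: (@measurable_fun_fubini_tonelli_F _ _ _ _ _ (lebm n m)
    (fun z : euclid R n * m.-tuple (euclid R n) =>
      (indicator_tuple (D c r) z.2 * `|g z.1 z.2|)%:E)).
    apply/measurable_EFinP; apply: measurable_funM; last first.
      exact: (measurableT_comp (@normr_measurable R setT) mg).
    exact: (measurableT_comp (measurable_indicator_tuple (mD c r)) measurable_snd).
  move=> z; rewrite lee_fin mulr_ge0//.
  by case/andP: (indicator_tuple01 (D c r) z.2).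
have est c r : 0 < r ->
    (forall x z, eball c r x -> eball c r z ->
      (\int[lebm n m]_y ((1 - indicator_tuple (D c r) y) * `|g x y - g z y|)%:E <=
       (far c r)%:E)%E) /\
    (\int[leb n]_(x in eball c r) near c r x <=
      (C1 * r `^ (n%:R + delta) * norm_product delta ps v beta_ c r f)%:E)%E.
  move=> r0; apply: EST => //; first by move=> i; exact: wn0.
  by move=> i; exact: (RAD c r r0).1.
have diff_le c r x z : 0 < r -> eball c r x -> eball c r z ->
    (\int[lebm n m]_y `|g x y - g z y|%:E <= near c r x + near c r z + (far c r)%:E)%E.
  move=> r0 xB zB; apply: le_trans (leeD2l _ ((est c r r0).1 x z xB zB)).
  have ind := @indicator_tuple01 R n m (D c r).
  have mI := @measurable_indicator_tuple R n m (D c r) (mD c r).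
  have m1 u : measurable_fun setT (fun y => (indicator_tuple (D c r) y * `|g u y|)%:E : \bar R).
    apply/measurable_EFinP; apply: measurable_funM => //.
    exact: (measurableT_comp (@normr_measurable R setT) (mgx u)).
  have mgg : measurable_fun setT (fun y => `|g x y - g z y|).
    exact: (measurableT_comp (@normr_measurable R setT) (measurable_funB (mgx x) (mgx z))).
  have m2 : measurable_fun setT (fun y =>
      ((1 - indicator_tuple (D c r) y) * `|g x y - g z y|)%:E : \bar R).
    apply/measurable_EFinP; apply: measurable_funM => //.
    exact: (measurable_funB (measurable_cst (1 : R)) mI).
  have p1 u y : (0 <= (indicator_tuple (D c r) y * `|g u y|)%:E)%E.
    by rewrite lee_fin mulr_ge0//; case/andP: (ind y).
  have p2 y : (0 <= ((1 - indicator_tuple (D c r) y) * `|g x y - g z y|)%:E)%E.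
    by rewrite lee_fin mulr_ge0// subr_ge0; case/andP: (ind y).
  rewrite /near -ge0_integralD// -ge0_integralD//; last 2 first.
  - by move=> y _; rewrite adde_ge0.
  - exact: emeasurable_funD.
  apply: ge0_le_integral => //.
  - exact/measurable_EFinP.
  - by do 2 apply: emeasurable_funD => //.
  move=> y _; rewrite -!EFinD lee_fin.
  have /andP[i0 i1] := ind y.
  have h := ler_normB (g x y) (g z y).
  have hh : indicator_tuple (D c r) y * `|g x y - g z y| <=
      indicator_tuple (D c r) y * (`|g x y| + `|g z y|) by exact: ler_wpM2l.
  by rewrite mulrDr in hh; rewrite mulrBl mul1r; lra.
have near_int c r : 0 < r -> (\int[leb n]_(x in eball c r) near c r x < +oo)%E.
  by move=> r0; apply: (le_lt_trans (est c r r0).2); rewrite ltry.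
(* The points at which the near part converges, for every ball of positive
   integer radius centred at the origin that contains the point; at such points
   all the differences of integrands are integrable. *)
pose o : euclid R n := nseq_tuple n (0 : R).
pose G x := forall k : nat, eball o k.+1%:R x -> (near o k.+1%:R x < +oo)%E.
have aeG : {ae leb n, forall x, G x}.
  apply: ae_foralln => k.
  have k1 : 0 < k.+1%:R :> R by [].
  have iN : (leb n).-integrable (eball o k.+1%:R) (near o k.+1%:R).
    apply/integrableP; split; first exact: measurable_funTS.
    by under eq_integral do rewrite gee0_abs//; exact: near_int.
  have := integrable_ae (measurable_eball _ _) iN.
  by apply: filterS => x h xB; have := h xB; rewrite ge0_fin_numE.
have dint x z : G x -> G z ->
    (lebm n m).-integrable setT (EFin \o (fun y => g x y - g z y)).
  move=> Gx Gz; apply/integrableP; split.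
    by apply/measurable_EFinP; exact: measurable_funB.
  pose k := Num.bound (Num.max (eucl_dist o x) (eucl_dist o z)).
  have hk : Num.max (eucl_dist o x) (eucl_dist o z) < k.+1%:R.
    apply: (@lt_trans _ _ k%:R); last by rewrite ltr_nat.
    by apply: archi_boundP; rewrite le_max eucl_dist_ge0.
  have xB : eball o k.+1%:R x by apply: le_lt_trans hk; rewrite le_max lexx.
  have zB : eball o k.+1%:R z by apply: le_lt_trans hk; rewrite le_max lexx orbT.
  have k1 : 0 < k.+1%:R :> R by [].
  apply: (le_lt_trans (diff_le o _ x z k1 xB zB)).
  apply: lte_add_pinfty; last exact: ltry.
  by apply: lte_add_pinfty; [exact: Gx|exact: Gz].
have osc (F : euclid R n -> R) : measurable_fun setT F ->
    (forall x z, G x -> G z ->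
      (`|F x - F z|%:E <= \int[lebm n m]_y `|g x y - g z y|%:E)%E) ->
    bounded_oscillation F.
  move=> mF FG.
  have mo c r (r0 : 0 < r) := @mean_oscillation_le _ _ R (leb n) (eball c r) F (near c r)
    (far c r) G (measurable_eball c r) (leb_eball_gt0 n0 c r0) (leb_eball_lty c r0) mF
    (mnear c r) (near_ge0 c r) (far0 c r r0) (near_int c r r0) aeG
    (fun x z Gx Gz xB zB => le_trans (FG x z Gx Gz) (diff_le c r x z r0 xB zB)).
  split.
    split => // c r; have [r0|r0] := ltP 0 r; first exact: (mo c r r0).1.
    rewrite (_ : eball c r = set0); first exact: integrable_set0.
    apply/seteqP; split => x //=; rewrite /eball/= => /lt_le_trans/(_ r0).
    by rewrite ltNge eucl_dist_ge0.
  move=> c r r0; have [_ mor] := mo c r r0.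
  have /andP[W0 Woo] := integral_inverse_weight_gt0 n0 c r0 hw iw.
  rewrite /weighted_oscillation.
  have [_ RADr] := RAD c r r0.
  set W := (\int[leb n]_(x in eball c r) (w x)^-1%:E)%E in W0 Woo RADr *.
  have WK : (fine W)%:E = W by rewrite fineK// gt0_fin_numE.
  have fW0 : 0 < fine W by rewrite fine_gt0// W0.
  set V := fine (leb n (eball c r)) in RADr.
  have V0 : 0 < V by exact: fine_leb_eball_gt0.
  rewrite -(leb_eball_fineK c r0) -/V poweR_EFin -WK -EFinM inver gt_eqF; last first.
    by rewrite mulr_gt0// powR_gt0.
  rewrite lee_pdivrMl; last by rewrite mulr_gt0// powR_gt0.
  apply: (le_trans mor).
  have -> : (\prod_(i < m) 'N[leb n]_(ps i) [EFin \o (fun x => f i x * v i x)%R])%E =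
      (\prod_i fine (nrm i))%:E by rewrite fine_prode.
  apply: (@le_trans _ _ (2%:E * (C1 * r `^ (n%:R + delta) *
      norm_product delta ps v beta_ c r f)%:E + (far c r)%:E * ((2 * r) ^+ n)%:E)%E).
    apply: leeD; first by apply: lee_wpmul2l => //; exact: (est c r r0).2.
    by apply: lee_wpmul2l; [rewrite lee_fin far0|exact: leb_eball_le].
  rewrite -!EFinM -EFinD lee_fin.
  have -> : 2 * (C1 * r `^ (n%:R + delta) * norm_product delta ps v beta_ c r f) +
      far c r * (2 * r) ^+ n = C1 * (2 + 2 ^+ n) * ((r `^ (n%:R + delta) *
      \prod_(i < m) fine (weight_norm delta ps v beta_ c r i)) * \prod_i fine (nrm i)).
    rewrite /far /norm_product big_split/= -/nrm.
    have -> : r `^ (n%:R + delta) = r `^ delta * r ^+ n.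
      by rewrite -powR_mulrn ?(ltW r0)// -powRD ?(gt_eqF r0) ?implybT// addrC.
    rewrite exprMn.
    move: (\prod_i _) (\prod_i _) (r `^ delta) (r ^+ n) (2 ^+ n) => u1 u2 u3 u4 u5.
    ring.
  rewrite /CC [leRHS](_ : _ = C1 * (2 + 2 ^+ n) * ((C2 * (fine W * V `^ (dt / n%:R))) *
    \prod_i fine (nrm i))); last by ring.
  apply: ler_wpM2l; first by rewrite mulr_ge0 ?(ltW C10)// addr_ge0 ?exprn_ge0.
  apply: ler_wpM2r RADr; apply: prodr_ge0 => i _; rewrite fine_ge0//; exact: Lnorm_ge0.
split.
  apply: osc; first exact: (measurable_fun_Rintegral (lebm n m) mg).
  move=> x z Gx Gz.
  (* By integrability of the differences, one absolutely convergent integral at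
     a point of G makes them all converge on G. *)
  have [[u [Gu iu]]|nu] := pselect (exists u, G u /\ (lebm n m).-integrable setT (EFin \o g u)).
    have ig a : G a -> (lebm n m).-integrable setT (EFin \o g a).
      by move=> Ga; apply: integrable_of_difference iu _; exact: dint.
    rewrite /product_commutator -RintegralB//; [|exact: ig|exact: ig].
    by apply: Rintegral_difference_le; exact: dint.
  have PC0 a : G a -> product_commutator K b f a = 0.
    move=> Ga; apply: Rintegral_not_integrable; first exact: mgx.
    by move=> ia; apply: nu; exists a.
  by rewrite !PC0// subrr normr0; apply: integral_ge0.
(* The representative modulo constants is normalized at a point of G. *)
have [z0 [_ Gz0]] : exists z, [set: euclid R n] z /\ G z.
  by apply: (ae_nonempty (mu := leb n)) => //; exact: leb_setT_gt0.
pose F x := \int[lebm n m]_y (g x y - g z0 y).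
have FE x z : G x -> G z -> F x - F z = \int[lebm n m]_y (g x y - g z y).
  move=> Gx Gz; rewrite /F -RintegralB//; [|exact: dint|exact: dint].
  by apply: eq_Rintegral => y _; rewrite opprB addrA subrK.
exists F; split.
  apply: filterS (aeG) => x Gx; apply: filterS (aeG) => z Gz; split; last exact: FE.
  exact: dint.
apply: osc.
  apply: (@measurable_fun_Rintegral _ _ _ _ _ (lebm n m)
    (fun z : euclid R n * m.-tuple (euclid R n) => g z.1 z.2 - g z0 z.2)).
  by apply: measurable_funB => //; exact: (measurableT_comp (mgx z0) measurable_snd).
by move=> x z Gx Gz; rewrite FE//; apply: Rintegral_difference_le; exact: dint.
Qed.
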